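(* Let $f:\mathbb{R}^n\to\mathbb{R}$ be of class $C^{2+}$ with $L_f$-Lipschitz continuous gradient, let $g:\mathbb{R}^n\to\mathbb{R}\cup\{+\infty\}$ be proper, lower semicontinuous and $\rho$-weakly convex, let $\varphi=f+g$ with $\operatorname{argmin}\varphi\neq\emptyset$, and suppose $\{x:\varphi(x)\le\varphi(x^0)\}$ is bounded. Let $(x^k)$ be generated by the NTRA algorithm described in the context, and suppose: $x^\star$ is a critical point which is a limit point of $(x^k)$; $f$ is of class $C^3$ locally around $x^\star$ and $\operatorname{prox}_{\gamma g}$ is of class $C^1$ locally around $x^\star-\gamma\nabla f(x^\star)$ (with $\gamma$ the algorithm's stepsize, assumed sufficiently small); $x^\star$ is a strong local minimizer of $\varphi$; there is $\beta\in(0,1)$ with $m_k(0)-m_k(d^k)\ge\beta\|\nabla\varphi_\gamma(x^k)\|\min\{\delta_k,\|\nabla\varphi_\gamma(x^k)\|/\|B_k\|\}$ for all $k$; and whenever $B_k\succ0$ and $d_N^k:=-B_k^{-1}\nabla\varphi_\gamma(x^k)$ satisfies $\|d_N^k\|\le\delta_k$, one has $d^k=d_N^k$. Then (i) the whole sequence $(x^k)$ converges to $x^\star$; (ii) eventually $d^k=d_N^k$ and this step is accepted, and $(x^k)$ converges to $x^\star$ superlinearly.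
   Context: $C^{2+}$: twice continuously differentiable with locally Lipschitz Hessian; $g$ is $\rho$-weakly convex if $g+\frac\rho2\|\cdot\|^2$ is convex. $\operatorname{prox}_{\gamma g}(x)=\operatorname{argmin}_z\{g(z)+\frac1{2\gamma}\|z-x\|^2\}$, $T_\gamma(x)=\operatorname{prox}_{\gamma g}(x-\gamma\nabla f(x))$, $R_\gamma(x)=\gamma^{-1}(x-T_\gamma(x))$; $x^\star$ is critical if $x^\star\in T_\gamma(x^\star)$. A strong local minimizer $x^\star$ of $\varphi$: there exist $c,\epsilon>0$ with $\varphi(x)\ge\varphi(x^\star)+c\|x-x^\star\|^2$ for all $x$ with $\|x-x^\star\|<\epsilon$. Forward-backward envelope $\varphi_\gamma(x)=\inf_u\{f(x)+\langle\nabla f(x),u-x\rangle+g(u)+\frac1{2\gamma}\|u-x\|^2\}$. $\partial_C$: Clarke generalized Jacobian. NTRA: given $x^0$, $\gamma\in(0,\min\{1/L_f,1/\rho\})$, $\delta_0>0$, $0<\mu_1<\mu_2<1$, $0<c_1<c_2<1<c_3$; for $k=0,1,\dots$: select $P_k\in\partial_C\operatorname{prox}_{\gamma g}(x^k-\gamma\nabla f(x^k))$; $Q_k=I-\gamma\nabla^2f(x^k)$, $B_k=\gamma^{-1}Q_k(I-P_kQ_k)$; stop if $R_\gamma(x^k)=0$ and $\lambda_{\min}(B_k)\ge0$; $d^k$ is an (approximate) solution of $\min_d m_k(d):=\varphi_\gamma(x^k)+\langle\nabla\varphi_\gamma(x^k),d\rangle+\frac12\langle B_kd,d\rangle$ s.t.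 $\|d\|\le\delta_k$; $\rho_k=\frac{\varphi_\gamma(x^k)-\varphi_\gamma(x^k+d^k)}{m_k(0)-m_k(d^k)}$; $x^{k+1}=x^k$ if $\rho_k<\mu_1$, else $x^k+d^k$; $\delta_{k+1}=c_1\delta_k$ if $\rho_k<\mu_1$, $c_2\delta_k$ if $\mu_1\le\rho_k<\mu_2$, $c_3\delta_k$ if $\rho_k\ge\mu_2$. *)

(* Defs.v *)
From HB Require Import structures.
From mathcomp Require Import all_boot all_order all_algebra.
From mathcomp Require Import all_classical all_reals all_analysis.
Set Implicit Arguments. Unset Strict Implicit. Unset Printing Implicit Defensive.
Import Order.TTheory GRing.Theory Num.Theory.
Import numFieldNormedType.Exports.
Local Open Scope classical_set_scope.
Local Open Scope ring_scope.

Section Defs.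
Variables (R : realType) (n : nat).
Notation vec := 'cV[R]_n.
Notation mat := 'M[R]_n.

Definition dotv (u v : vec) : R := \sum_(i < n) u i 0 * v i 0.
Definition enorm (u : vec) : R := Num.sqrt (dotv u u).

Definition opnorm (B : mat) : R :=
  sup [set enorm (B *m u) | u in [set u : vec | enorm u <= 1]].

Definition grad (h : vec -> R) (x : vec) : vec :=
  \col_(i < n) ('d h x (delta_mx i 0 : vec)).
Definition jac (F : vec -> vec) (x : vec) : mat :=
  \matrix_(i < n, j < n) ('d F x (delta_mx j 0 : vec)) i 0.
Definition hess (h : vec -> R) (x : vec) : mat := jac (grad h) x.

Definition C2plus (h : vec -> R) : Prop :=
  (forall x, differentiable h x) /\
  (forall x, differentiable (grad h) x) /\
  (forall x, {for x, continuous (hess h)}) /\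
  (forall x, exists2 r : R, 0 < r & exists K : R, forall y z,
      enorm (y - x) < r -> enorm (z - x) < r ->
      `|hess h y - hess h z| <= K * enorm (y - z)).

Definition C1_near (V : normedModType R) (F : vec -> V) (x : vec) : Prop :=
  exists2 r : R, 0 < r &
    (forall y, enorm (y - x) < r -> differentiable F y) /\
    (forall y, enorm (y - x) < r -> forall v : vec,
        {for y, continuous (fun z => 'd F z v)}).

Definition C3_near (h : vec -> R) (x : vec) : Prop := C1_near (hess h) x.

Definition proper_fun (g : vec -> \bar R) : Prop :=
  (forall x, g x != -oo%E) /\ (exists x, g x != +oo%E).

Definition convex_ext (h : vec -> \bar R) : Prop :=
  forall (x y : vec) (t : R), 0 < t < 1 ->
    (h (t *: x + (1 - t) *: y)%R <= t%:E * h x + (1 - t)%:E * h y)%E.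

Definition weakly_convex (rho : R) (g : vec -> \bar R) : Prop :=
  convex_ext (fun x => g x + (rho / 2 * enorm x ^+ 2)%:E)%E.

Definition is_prox (gamma : R) (g : vec -> \bar R) (x z : vec) : Prop :=
  forall w, (g z + (1 / (2 * gamma) * enorm (z - x) ^+ 2)%:E <=
             g w + (1 / (2 * gamma) * enorm (w - x) ^+ 2)%:E)%E.

(* prox_{gamma g} as a function: a chosen minimizer (it is unique when
   gamma < 1/rho) *)
Definition prox (gamma : R) (g : vec -> \bar R) (x : vec) : vec :=
  xget 0 [set z | is_prox gamma g x z].

Definition Tg (f : vec -> R) g gamma (x : vec) : vec :=
  prox gamma g (x - gamma *: grad f x).
Definition Rg (f : vec -> R) g gamma (x : vec) : vec :=
  gamma^-1 *: (x - Tg f g gamma x).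

Definition fbe (f : vec -> R) (g : vec -> \bar R) (gamma : R) (x : vec) : R :=
  fine (ereal_inf (range (fun u : vec =>
    ((f x + dotv (grad f x) (u - x) + 1 / (2 * gamma) * enorm (u - x) ^+ 2)%:E
     + g u)%E))).

Definition mconv (S : set mat) : set mat :=
  [set A | exists (k : nat) (w : 'I_k -> R) (M : 'I_k -> mat),
     (forall i, 0 <= w i) /\ \sum_(i < k) w i = 1 /\ (forall i, S (M i)) /\
     A = \sum_(i < k) w i *: M i].

Definition clarke (F : vec -> vec) (x : vec) : set mat :=
  mconv [set M | exists y : nat -> vec,
     y @ \oo --> x /\ (forall k, differentiable F (y k)) /\
     (fun k => jac F (y k)) @ \oo --> M].

Definition lmin_ge0 (B : mat) : Prop := forall a : R, eigenvalue B a -> 0 <= a.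

Definition posdef (B : mat) : Prop :=
  B^T = B /\ forall u : vec, u != 0 -> 0 < dotv u (B *m u).

Definition Qm (f : vec -> R) gamma (x : vec) : mat := 1%:M - gamma *: hess f x.
Definition Bm (f : vec -> R) gamma (x : vec) (P : mat) : mat :=
  gamma^-1 *: (Qm f gamma x *m (1%:M - P *m Qm f gamma x)).
Definition model f g gamma (x : vec) (P : mat) (d : vec) : R :=
  fbe f g gamma x + dotv (grad (fbe f g gamma) x) d
  + 1 / 2 * dotv (Bm f gamma x P *m d) d.
Definition tr_ratio f g gamma (x : vec) (P : mat) (d : vec) : R :=
  (fbe f g gamma x - fbe f g gamma (x + d)) /
  (model f g gamma x P 0 - model f g gamma x P d).
Definition newton_dir f g gamma (x : vec) (P : mat) : vec :=
  - (invmx (Bm f gamma x P) *m grad (fbe f g gamma) x).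
(* min{delta, ||v||/||B||}, with ||v||/0 = +oo *)
Definition cauchy_rad (delta : R) (v : vec) (B : mat) : R :=
  if opnorm B == 0 then delta else Num.min delta (enorm v / opnorm B).

(* (x, delta, P, d) is an (infinite, non-terminating) run of NTRA *)
Definition NTRA_run (f : vec -> R) (g : vec -> \bar R) (gamma delta0 mu1 mu2
    c1 c2 c3 : R) (x0 : vec) (x : nat -> vec) (delta : nat -> R)
    (P : nat -> mat) (d : nat -> vec) : Prop :=
  x 0%N = x0 /\ delta 0%N = delta0 /\
  forall k : nat,
    [/\ clarke (prox gamma g) (x k - gamma *: grad f (x k)) (P k),
        ~ (Rg f g gamma (x k) = 0 /\ lmin_ge0 (Bm f gamma (x k) (P k))),
        enorm (d k) <= delta k,
        x k.+1 = (if tr_ratio f g gamma (x k) (P k) (d k) < mu1 then x k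
                  else x k + d k) &
        delta k.+1 = (if tr_ratio f g gamma (x k) (P k) (d k) < mu1 then c1 * delta k
                      else if tr_ratio f g gamma (x k) (P k) (d k) < mu2
                           then c2 * delta k else c3 * delta k)].

End Defs.

(* Main.v *)
(* Write T for the forward-backward map, Phi for the forward-backward envelope,
   xs for the critical point and Bs for the matrix B(xs).

   The gradient of Phi is Q R_gamma, where Q is locally Lipschitz and
   R_gamma(xs) = 0, so it is strictly differentiable at xs with derivative Bs; the
   Clarke Jacobian of the prox is a singleton near xs - gamma grad f(xs), so B_k is
   close to Bs as soon as x_k is close to xs. The descent lemma gives
   Phi(x) >= phi(T x) + (1/(2 gamma) - Lf/2) |T x - x|^2, and with the strong local
   minimality of phi this makes Phi grow quadratically around xs, whence Bs is
   positive definite.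

   Close to xs the model decrease is then at least a multiple of |d_k|^2, while it
   differs from the actual decrease by o(|d_k|^2): every step is very successful
   and |d_k| = O(|x_k - xs|). As Phi(x_k) is nonincreasing and Phi grows
   quadratically, an iterate close enough to xs traps all later ones, so (x_k)
   converges to xs. The radii then grow geometrically, the Newton steps are taken,
   and Newton's method converges superlinearly. *)

Require Import Defs.
From HB Require Import structures.
From mathcomp Require Import all_boot all_order all_algebra.
From mathcomp Require Import all_classical all_reals all_analysis.
From mathcomp Require Import ring lra.
Set Implicit Arguments. Unset Strict Implicit. Unset Printing Implicit Defensive.
Import Order.TTheory GRing.Theory Num.Theory.
Import numFieldNormedType.Exports.
Local Open Scope classical_set_scope.
Local Open Scope ring_scope.

(** * Euclidean geometry of column vectors *)

Section EuclideanNorm.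
Context {R : realType} {n : nat}.
Implicit Types (u v w x y : 'cV[R]_n) (A B : 'M[R]_n) (a b : R).

Lemma dotvC u v : dotv u v = dotv v u.
Proof. by apply: eq_bigr => i _; rewrite mulrC. Qed.

Lemma dotvDr u v w : dotv u (v + w) = dotv u v + dotv u w.
Proof. by rewrite -big_split; apply: eq_bigr => i _; rewrite mxE mulrDr. Qed.

Lemma dotvZr a u v : dotv u (a *: v) = a * dotv u v.
Proof. by rewrite big_distrr; apply: eq_bigr => i _; rewrite mxE mulrCA. Qed.

Lemma dotvDl u v w : dotv (u + v) w = dotv u w + dotv v w.
Proof. by rewrite !(dotvC _ w) dotvDr. Qed.

Lemma dotvZl a u v : dotv (a *: u) v = a * dotv u v.
Proof. by rewrite !(dotvC _ v) dotvZr. Qed.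

Lemma dotvNr u v : dotv u (- v) = - dotv u v.
Proof. by rewrite -scaleN1r dotvZr mulN1r. Qed.

Lemma dotvNl u v : dotv (- u) v = - dotv u v.
Proof. by rewrite -scaleN1r dotvZl mulN1r. Qed.

Lemma dotvBr u v w : dotv u (v - w) = dotv u v - dotv u w.
Proof. by rewrite dotvDr dotvNr. Qed.

Lemma dotvBl u v w : dotv (u - v) w = dotv u w - dotv v w.
Proof. by rewrite dotvDl dotvNl. Qed.

Lemma dotv0r u : dotv u 0 = 0.
Proof. by rewrite -(scale0r 0) dotvZr mul0r. Qed.

Lemma dotv0l u : dotv 0 u = 0.
Proof. by rewrite dotvC dotv0r. Qed.

Definition dotvE := (dotvDl, dotvDr, dotvNl, dotvNr, dotvZl, dotvZr, dotv0l, dotv0r).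

Lemma dotv_mulmx u A v : dotv u (A *m v) = dotv (A^T *m u) v.
Proof.
rewrite /dotv; under eq_bigr do rewrite mxE big_distrr.
rewrite exchange_big; apply: eq_bigr => j _; rewrite mxE big_distrl.
by apply: eq_bigr => i _ /=; rewrite mxE mulrA (mulrC (u _ _)).
Qed.

Lemma dotvv_ge0 u : 0 <= dotv u u.
Proof. by apply: sumr_ge0 => i _; rewrite -expr2 sqr_ge0. Qed.

Lemma enorm_ge0 u : 0 <= enorm u.
Proof. exact: sqrtr_ge0. Qed.

Lemma enorm_sqr u : enorm u ^+ 2 = dotv u u.
Proof. by rewrite sqr_sqrtr// dotvv_ge0. Qed.

Lemma enorm0 : enorm (0 : 'cV[R]_n) = 0.
Proof. by rewrite /enorm dotv0l sqrtr0. Qed.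

Lemma enorm_eq0 u : enorm u = 0 -> u = 0.
Proof.
move=> u0; apply/matrixP => i j; rewrite ord1 mxE; apply/eqP.
rewrite -sqrf_eq0 eq_le sqr_ge0 andbT.
have : dotv u u <= 0 by rewrite -enorm_sqr u0 expr0n.
apply: le_trans; rewrite /dotv (bigD1 i)//= -expr2 lerDl.
by apply: sumr_ge0 => k _; rewrite -expr2 sqr_ge0.
Qed.

Lemma enorm_gt0 u : (0 < enorm u) = (u != 0).
Proof.
rewrite lt_def enorm_ge0 andbT; congr (~~ _); apply/eqP/eqP => [/enorm_eq0//|->].
exact: enorm0.
Qed.

Lemma enormZ a u : enorm (a *: u) = `|a| * enorm u.
Proof.
by rewrite /enorm dotvZl dotvZr mulrA -expr2 sqrtrM ?sqr_ge0// sqrtr_sqr.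
Qed.

Lemma enormN u : enorm (- u) = enorm u.
Proof. by rewrite -scaleN1r enormZ normrN1 mul1r. Qed.

Lemma enormB u v : enorm (u - v) = enorm (v - u).
Proof. by rewrite -enormN opprB. Qed.

(** The square of [dotv v v *: u - dotv u v *: v] is nonnegative, and it equals [dotv v v] times the
    Cauchy-Schwarz defect [|u|^2 |v|^2 - dotv u v ^+ 2]. *)
Lemma cauchy_schwarz u v : `|dotv u v| <= enorm u * enorm v.
Proof.
have [->|v0] := eqVneq v 0; first by rewrite dotv0r enorm0 normr0 mulr0.
have vp : 0 < enorm v by rewrite enorm_gt0.
rewrite -(@ler_pXn2r _ 2) ?nnegrE ?mulr_ge0 ?enorm_ge0//.
rewrite exprMn real_normK ?num_real//.
have := dotvv_ge0 (dotv v v *: u - dotv u v *: v).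
rewrite !dotvE !enorm_sqr (dotvC v u).
have : 0 < dotv v v by rewrite -enorm_sqr exprn_gt0.
move: (dotv v v) (dotv u u) (dotv u v) => p q s p0.
rewrite [X in 0 <= X](_ : _ = p * (q * p - s ^+ 2)); last by ring.
by rewrite pmulr_rge0// subr_ge0.
Qed.

Lemma dotv_le u v : dotv u v <= enorm u * enorm v.
Proof. exact: le_trans (ler_norm _) (cauchy_schwarz _ _). Qed.

Lemma ler_enormD u v : enorm (u + v) <= enorm u + enorm v.
Proof.
rewrite -(@ler_pXn2r _ 2) ?nnegrE ?addr_ge0 ?enorm_ge0//.
rewrite sqrrD !enorm_sqr !dotvE (dotvC v u).
by have := dotv_le u v; lra.
Qed.

Lemma ler_enormB u v : enorm (u - v) <= enorm u + enorm v.
Proof. by rewrite -(enormN v) ler_enormD. Qed.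

Lemma ler_enorm_distD w u v : enorm (u - v) <= enorm (u - w) + enorm (w - v).
Proof. by rewrite -{1}(subrK w u) -addrA ler_enormD. Qed.

Lemma entry_le_norm m p (M : 'M[R]_(m, p)) i j : `|M i j| <= `|M|.
Proof.
rewrite [leRHS]/Num.Def.normr/= mx_normrE.
exact: (le_bigmax _ (fun k : 'I_m * 'I_p => `|M k.1 k.2|) (i, j)).
Qed.

Lemma norm_le_entry m p (M : 'M[R]_(m, p)) a : 0 <= a ->
  (forall i j, `|M i j| <= a) -> `|M| <= a.
Proof.
move=> a0 Ma; rewrite [leLHS]/Num.Def.normr/= mx_normrE; apply/bigmax_leP; split => //.
Qed.

Lemma entry_le_enorm u i : `|u i 0| <= enorm u.
Proof.
rewrite -(@ler_pXn2r _ 2) ?nnegrE ?enorm_ge0// enorm_sqr real_normK ?num_real//.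
rewrite /dotv (bigD1 i)//= -expr2 lerDl.
by apply: sumr_ge0 => k _; rewrite -expr2 sqr_ge0.
Qed.

Lemma norm_le_enorm u : `|u| <= enorm u.
Proof.
by apply: norm_le_entry (enorm_ge0 _) _ => i j; rewrite ord1 entry_le_enorm.
Qed.

Lemma enorm_le_entry u a : 0 <= a -> (forall i, `|u i 0| <= a) ->
  enorm u <= n%:R * a.
Proof.
move=> a0 ua; rewrite -(@ler_pXn2r _ 2) ?nnegrE ?mulr_ge0 ?enorm_ge0 ?ler0n//.
rewrite enorm_sqr; have -> : dotv u u = \sum_(i < n) `|u i 0| ^+ 2.
  by apply: eq_bigr => i _; rewrite real_normK ?num_real// expr2.
apply: le_trans (_ : \sum_(i < n) a ^+ 2 <= _).
  by apply: ler_sum => i _; rewrite ler_pXn2r ?nnegrE.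
rewrite sumr_const card_ord exprMn -[X in X <= _]mulr_natl ler_wpM2r ?sqr_ge0//.
by rewrite -natrX ler_nat; rewrite -mulnn; case: (n) => // k; rewrite leq_pmulr.
Qed.

Lemma enorm_le_norm u : enorm u <= n%:R * `|u|.
Proof. by apply: enorm_le_entry => // i; exact: entry_le_norm. Qed.

Lemma enorm_mulmx A u : enorm (A *m u) <= n%:R ^+ 2 * `|A| * enorm u.
Proof.
have -> : n%:R ^+ 2 * `|A| * enorm u = n%:R * (n%:R * `|A| * enorm u) by ring.
apply: enorm_le_entry => [|i]; first by rewrite !mulr_ge0 ?ler0n ?enorm_ge0.
rewrite mxE (le_trans (ler_norm_sum _ _ _))//.
apply: le_trans (_ : \sum_(j < n) (`|A| * enorm u) <= _).
  by apply: ler_sum => j _; rewrite normrM ler_pM ?entry_le_norm ?entry_le_enorm.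
by rewrite sumr_const card_ord -[X in X <= _]mulr_natl mulrA.
Qed.

(** The library topology on columns comes from the entrywise sup norm; the equivalence of the two
    norms transfers it to [enorm]. *)
Lemma cvg_enormP (x_ : nat -> 'cV[R]_n) x :
  x_ @ \oo --> x <->
  forall e : R, 0 < e -> exists N, forall k, (N <= k)%N -> enorm (x_ k - x) < e.
Proof.
split=> [xx e e0|H].
  (* Adding 1 to the comparison constant [n%:R] keeps the divisor positive when [n = 0]. The same
     device recurs below with other constants that may vanish. *)
  have e1 : 0 < e / (n%:R + 1) by rewrite divr_gt0// ltr_wpDl.
  have /cvgrPdist_lt/(_ _ e1) [N _ HN] := xx.
  exists N => k /HN /=; rewrite distrC => xkx.
  apply: le_lt_trans (enorm_le_norm _) _.
  rewrite ltr_pdivlMr ?ltr_wpDl// in xkx.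
  apply: le_lt_trans xkx; rewrite mulrC ler_wpM2l// lerDl; exact: ler01.
apply/cvgrPdist_lt => e /H[N HN]; exists N => // k /HN /=; rewrite enormB.
exact/le_lt_trans/norm_le_enorm.
Qed.

Lemma nbhs_enormP x (Q : 'cV[R]_n -> Prop) :
  (\forall y \near x, Q y) <->
  exists2 r : R, 0 < r & forall y, enorm (y - x) < r -> Q y.
Proof.
split=> [/nbhs_ballP[r /= r0 rQ]|[r r0 rQ]].
  exists r => // y yx; apply: rQ; rewrite -ball_normE /= distrC.
  exact: le_lt_trans (norm_le_enorm _) yx.
have r1 : 0 < r / (n%:R + 1) by rewrite divr_gt0// ltr_wpDl.
apply/nbhs_ballP; exists (r / (n%:R + 1)) => //= y.
rewrite -ball_normE /= distrC ltr_pdivlMr ?ltr_wpDl// => yx.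
apply: rQ; apply: le_lt_trans (enorm_le_norm _) _; apply: le_lt_trans yx.
by rewrite mulrC ler_wpM2l// lerDl ler01.
Qed.

Lemma enorm_mulmx_small (e : R) : 0 < e ->
  exists2 r : R, 0 < r & forall A, `|A| <= r -> forall u, enorm (A *m u) <= e * enorm u.
Proof.
move=> e0; have c0 : 0 < (n%:R ^+ 2 + 1 : R) by rewrite ltr_wpDl ?exprn_ge0.
exists (e / (n%:R ^+ 2 + 1)) => [|A]; first by rewrite divr_gt0.
rewrite ler_pdivlMr// => Ae u; apply: le_trans (enorm_mulmx _ _) _.
rewrite ler_wpM2r ?enorm_ge0//; apply: le_trans Ae.
by rewrite mulrC ler_wpM2l// lerDl ler01.
Qed.

End EuclideanNorm.

(** * Gradients and Jacobians *)

Section Differentiation.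
Context {R : realType} {n : nat}.
Implicit Types (u v w x y z d : 'cV[R]_n) (A B : 'M[R]_n) (h : 'cV[R]_n -> R)
  (F : 'cV[R]_n -> 'cV[R]_n).

(** Fréchet differentiability in epsilon form for [enorm]. Unlike [grad], which is a total function,
    it asserts that the derivative exists. *)
Definition hasgrad h x v := forall e : R, 0 < e -> exists2 r : R, 0 < r &
  forall y, enorm (y - x) < r -> `|h y - h x - dotv v (y - x)| <= e * enorm (y - x).

Definition hasjac F x A := forall e : R, 0 < e -> exists2 r : R, 0 < r &
  forall y, enorm (y - x) < r ->
    enorm (F y - F x - A *m (y - x)) <= e * enorm (y - x).

(** Strict differentiability: both points vary, so [F] is compared with one matrix between any two
    points near [x]. *)
Definition strict_jac F x A := forall e : R, 0 < e -> exists2 r : R, 0 < r &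
  forall y z, enorm (y - x) < r -> enorm (z - x) < r ->
    enorm (F y - F z - A *m (y - z)) <= e * enorm (y - z).

Lemma strict_jac_hasjac F x A : strict_jac F x A -> hasjac F x A.
Proof.
move=> FA e /FA[r r0 H]; exists r => // y yx; apply: H => //.
by rewrite subrr enorm0.
Qed.

Lemma differentiable_eps (W : normedModType R) (F : 'cV[R]_n -> W) x :
  differentiable F x -> forall e : R, 0 < e -> exists2 r : R, 0 < r &
  forall y, enorm (y - x) < r -> `|F y - F x - 'd F x (y - x)| <= e * `|y - x|.
Proof.
move=> /diff_locally/eqaddoP H e e0.
have /nbhs_enormP[r r0 Hr] := H _ e0; exists r => // y yx.
have := Hr (y - x); rewrite subr0 => /(_ yx) /=.
by rewrite !fctE /= subrK opprD addrA.
Qed.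

Lemma vec_delta u : u = \sum_(j < n) u j 0 *: (delta_mx j 0 : 'cV[R]_n).
Proof. by rewrite {1}(matrix_sum_delta u); apply: eq_bigr => i _; rewrite big_ord1. Qed.

Lemma diff_jac F x v : 'd F x v = jac F x *m v.
Proof.
rewrite {1}(vec_delta v) linear_sum /=; apply/matrixP => i j; rewrite ord1.
rewrite summxE mxE; apply: eq_bigr => k _.
by rewrite linearZ /= !mxE mulrC.
Qed.

Lemma diff_grad h x v : 'd h x v = dotv (grad h x) v.
Proof.
rewrite {1}(vec_delta v) linear_sum /=; apply: eq_bigr => k _.
by rewrite linearZ /= !mxE mulrC.
Qed.

Lemma differentiable_hasjac F x : differentiable F x -> hasjac F x (jac F x).
Proof.
move=> dF e e0; have e1 : 0 < e / (n%:R + 1) by rewrite divr_gt0// ltr_wpDl.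
have [r r0 H] := differentiable_eps dF e1.
exists r => // y /H; rewrite diff_jac => Hy.
apply: le_trans (enorm_le_norm _) _.
apply: (@le_trans _ _ (n%:R * (e / (n%:R + 1) * enorm (y - x)))).
  rewrite ler_wpM2l//; apply: le_trans Hy _.
  by rewrite ler_wpM2l ?norm_le_enorm// ltW.
rewrite mulrA ler_wpM2r ?enorm_ge0// mulrCA ler_piMr ?(ltW e0)//.
by rewrite ler_pdivrMr ?ltr_wpDl// mul1r lerDl ler01.
Qed.

Lemma differentiable_hasgrad h x : differentiable h x -> hasgrad h x (grad h x).
Proof.
move=> dh e e0; have [r r0 H] := differentiable_eps dh e0.
exists r => // y /H; rewrite diff_grad => /le_trans; apply.
by rewrite ler_wpM2l ?norm_le_enorm// ltW.
Qed.

Lemma dotv_linear v : linear (dotv v : 'cV[R]_n -> R^o).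
Proof. by move=> a u w; rewrite dotvDr dotvZr. Qed.

Lemma dotv_continuous v : continuous (dotv v).
Proof.
move=> y; apply/(@cvgrPdist_lt _ _ _ (nbhs y)) => e e0; apply/nbhs_enormP.
have c0 : 0 < enorm v + 1 by rewrite ltr_wpDl ?enorm_ge0.
exists (e / (enorm v + 1)); first by rewrite divr_gt0.
move=> z; rewrite ltr_pdivlMr// enormB => zy.
rewrite -dotvBr; apply: le_lt_trans (cauchy_schwarz _ _) _.
apply: le_lt_trans zy; rewrite mulrC ler_wpM2l ?enorm_ge0//.
by rewrite lerDl ler01.
Qed.

(** Uniqueness of the differential. [dotv v] is packed as a continuous linear map so that
    [diff_unique] can identify it with ['d h x]. *)
Lemma hasgradE h x v : hasgrad h x v -> grad h x = v.
Proof.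
move=> hv.
pose L := GRing.isLinear.Build _ _ _ _ (dotv v : 'cV[R]_n -> R^o) (dotv_linear v).
pose l : {linear 'cV[R]_n -> R} := HB.pack (dotv v : 'cV[R]_n -> R^o) L.
have lc : continuous l := @dotv_continuous v.
have E : 'd h x = l :> ('cV[R]_n -> R).
  apply: diff_unique => //; apply/eqaddoP => e e0; apply/nbhs_enormP.
  have e1 : 0 < e / (n%:R + 1) by rewrite divr_gt0// ltr_wpDl.
  have [r r0 H] := hv _ e1; exists r => // y; rewrite subr0 => yr.
  have := H (y + x); rewrite addrK => /(_ yr).
  rewrite !fctE /= opprD addrA => /le_trans; apply.
  apply: (@le_trans _ _ (e / (n%:R + 1) * (n%:R * `|y|))).
    by rewrite ler_wpM2l ?enorm_le_norm// ltW.
  rewrite mulrA ler_wpM2r// -mulrA ler_piMr ?(ltW e0)//.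
  by rewrite mulrC ler_pdivrMr ?ltr_wpDl// mul1r lerDl ler01.
apply/matrixP => i j; rewrite ord1 mxE E /l /= /dotv (bigD1 i)//= big1.
  by rewrite mxE !eqxx mulr1 addr0.
by move=> k ki; rewrite mxE (negbTE ki) mulr0.
Qed.

Lemma is_derive_eps (p : R -> R) (t a : R) :
  (forall e : R, 0 < e -> exists2 r : R, 0 < r & forall s, `|s - t| < r ->
    `|p s - p t - a * (s - t)| <= e * `|s - t|) -> is_derive t 1 p a.
Proof.
move=> H.
have C : (fun s : R => s^-1 *: (p (s *: 1 + t) - p t)) @ 0^' --> a.
  apply/cvgrPdist_le => e /H[r r0 Hr].
  rewrite near_withinE; apply/nbhs_ballP; exists r => //= s.
  rewrite -ball_normE /= sub0r normrN => sr s0.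
  have s1 : `|s| != 0 by rewrite normr_eq0.
  have := Hr (s + t); rewrite addrK => /(_ sr) E.
  rewrite distrC [s *: 1]mulr1 -(ler_pM2r (_ : 0 < `|s|)) ?normr_gt0// -normrM mulrBl.
  by rewrite /GRing.scale /= mulrAC mulVf// mul1r.
by apply: DeriveDef; [apply/cvg_ex; exists a|exact: cvg_lim].
Qed.

Lemma hasgrad_line h x d v (t : R) : hasgrad h (x + t *: d) v ->
  is_derive t 1 (fun s => h (x + s *: d)) (dotv v d).
Proof.
move=> H; apply: is_derive_eps => e e0.
have c0 : 0 < enorm d + 1 by rewrite ltr_wpDl ?enorm_ge0.
have [r r0 Hr] := H (e / (enorm d + 1)) (divr_gt0 e0 c0).
exists (r / (enorm d + 1)); first exact: divr_gt0.
move=> s; rewrite ltr_pdivlMr// => sr.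
have E : x + s *: d - (x + t *: d) = (s - t) *: d.
  by rewrite opprD addrACA subrr add0r -scalerBl.
have := Hr (x + s *: d); rewrite E enormZ dotvZr (mulrC (s - t)).
have dle : enorm d <= enorm d + 1 by rewrite lerDl ler01.
move=> /(_ (le_lt_trans (ler_wpM2l (normr_ge0 _) dle) sr)) /le_trans; apply.
rewrite mulrCA mulrC ler_wpM2r// mulrAC ler_pdivrMr// ler_wpM2l//.
exact: ltW.
Qed.

(* Mean value theorem for [h (x + t d) - t <F x, d> - t^2 q / 2]. *)
Lemma taylor_mvt h F x d (q : R) :
  (forall t : R, 0 <= t <= 1 -> hasgrad h (x + t *: d) (F (x + t *: d))) ->
  exists2 c : R, 0 <= c <= 1 &
    h (x + d) - h x - dotv (F x) d - q / 2 = dotv (F (x + c *: d) - F x) d - c * q.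
Proof.
move=> H.
pose p s : R := h (x + s *: d) - s * dotv (F x) d - s ^+ 2 * (q / 2).
have D (t : R) : 0 <= t <= 1 ->
    is_derive t 1 p (dotv (F (x + t *: d) - F x) d - t * q).
  move=> /H/hasgrad_line h1; rewrite /p; apply: is_derive_eq.
  by rewrite dotvBl /GRing.scale /=; field.
have [|||c] := @MVT_segment _ p (fun t => dotv (F (x + t *: d) - F x) d - t * q) 0 1.
- exact: ler01.
- by move=> t; rewrite in_itv /= => /andP[t0 t1]; apply: D; rewrite !ltW.
- apply: derivable_within_continuous => t; rewrite in_itv /= => /D Dt.
  exact: ex_derive.
rewrite in_itv /= => c01; rewrite /p => E; exists c => //.
move: E; rewrite subr0 mulr1 => <-.
by rewrite scale0r scale1r addr0; field.
Qed.

Lemma hasgrad_mvt h F x d :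
  (forall t : R, 0 <= t <= 1 -> hasgrad h (x + t *: d) (F (x + t *: d))) ->
  exists2 c : R, 0 <= c <= 1 & h (x + d) - h x = dotv (F (x + c *: d)) d.
Proof.
move=> /(@taylor_mvt _ _ _ _ 0)[c c01 E]; exists c => //; move: E.
by rewrite dotvBl; lra.
Qed.

Lemma hasgradD h1 h2 x v1 v2 : hasgrad h1 x v1 -> hasgrad h2 x v2 ->
  hasgrad (fun y => h1 y + h2 y) x (v1 + v2).
Proof.
move=> H1 H2 e e0; have e2 : 0 < e / 2 by rewrite divr_gt0.
have [r1 r10 {}H1] := H1 _ e2; have [r2 r20 {}H2] := H2 _ e2.
exists (Num.min r1 r2); first by rewrite lt_min r10.
move=> y; rewrite lt_min => /andP[/H1 {}H1 /H2 {}H2]; rewrite dotvDl.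
rewrite (_ : _ - _ = (h1 y - h1 x - dotv v1 (y - x)) +
  (h2 y - h2 x - dotv v2 (y - x))); last by ring.
by apply: le_trans (ler_normD _ _) _; lra.
Qed.

Lemma hasgradZ (a : R) h x v : hasgrad h x v -> hasgrad (fun y => a * h y) x (a *: v).
Proof.
move=> H e e0; have c0 : 0 < `|a| + 1 by rewrite ltr_wpDl.
have [r r0 {}H] := H (e / (`|a| + 1)) (divr_gt0 e0 c0).
exists r => // y /H {}H; rewrite dotvZl -!mulrBr normrM.
apply: le_trans (ler_wpM2l (normr_ge0 _) H) _.
rewrite mulrA ler_wpM2r ?enorm_ge0// mulrCA ler_piMr ?(ltW e0)//.
by rewrite ler_pdivrMr// mul1r lerDl ler01.
Qed.

Lemma hasgrad_dotvv x : hasgrad (fun y => dotv y y) x (2 *: x).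
Proof.
move=> e e0; exists e => // y yx.
rewrite (_ : _ - _ = dotv (y - x) (y - x)); last first.
  by rewrite !dotvE (dotvC y x); ring.
by rewrite ger0_norm ?dotvv_ge0// -enorm_sqr expr2 ler_wpM2r ?enorm_ge0// ltW.
Qed.

Lemma hasgrad_dotvl w x : hasgrad (dotv w) x w.
Proof.
move=> e e0; exists 1 => // y _; rewrite -dotvBr subrr normr0.
by rewrite mulr_ge0 ?enorm_ge0// ltW.
Qed.

Lemma hasjac_lip F x A : hasjac F x A -> exists2 r : R, 0 < r &
  exists2 C : R, 0 < C & forall y, enorm (y - x) < r ->
    enorm (F y - F x) <= C * enorm (y - x).
Proof.
move=> /(_ 1 ltr01)[r r0 H]; exists r => //.
exists (1 + n%:R ^+ 2 * `|A|) => [|y /H {}H].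
  by rewrite ltr_wpDr// mulr_ge0// exprn_ge0.
rewrite -(subrK (A *m (y - x)) (F y - F x)).
by apply: le_trans (ler_enormD _ _) _; rewrite mulrDl lerD// enorm_mulmx.
Qed.

Lemma hasgrad_comp h F x v A : hasgrad h (F x) v -> hasjac F x A ->
  hasgrad (h \o F) x (A^T *m v).
Proof.
move=> hv FA e e0.
have [r r0 [C C0 HC]] := hasjac_lip FA.
have e2 : 0 < e / 2 / C by rewrite !divr_gt0.
have [r1 r10 {}hv] := hv _ e2.
have v0 : 0 < enorm v + 1 by rewrite ltr_wpDl ?enorm_ge0.
have e3 : 0 < e / 2 / (enorm v + 1) by rewrite !divr_gt0.
have [r2 r20 {}FA] := FA _ e3.
exists (Num.min (r1 / C) (Num.min r r2)); first by rewrite !lt_min divr_gt0// r0.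
move=> y; rewrite !lt_min => /and3P[yr1 /HC {}HC /FA {}FA].
have /hv {}hv : enorm (F y - F x) < r1.
  by apply: le_lt_trans HC _; rewrite mulrC -ltr_pdivlMr.
rewrite /= -dotv_mulmx.
(* The error splits into that of [h] at [F x] and [v] paired with that of [F] at [x]; each gets half
   of [e]. *)
rewrite (_ : _ - _ = (h (F y) - h (F x) - dotv v (F y - F x)) +
   dotv v (F y - F x - A *m (y - x))); last by rewrite !dotvBr; ring.
apply: le_trans (ler_normD _ _) _; rewrite (splitr e) mulrDl lerD//.
  apply: le_trans hv _; rewrite -mulrA ler_wpM2l ?divr_ge0 ?(ltW e0)//.
  by rewrite mulrC ler_pdivrMr// mulrC.
apply: le_trans (cauchy_schwarz _ _) _.
apply: le_trans (ler_wpM2l (enorm_ge0 _) FA) _.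
rewrite mulrA ler_wpM2r ?enorm_ge0// mulrCA ler_piMr ?divr_ge0 ?(ltW e0)//.
by rewrite ler_pdivrMr// mul1r lerDl ler01.
Qed.

Lemma hasjac_id_sub (a : R) F x A : hasjac F x A ->
  hasjac (fun y => y - a *: F y) x (1%:M - a *: A).
Proof.
move=> H e e0; have c0 : 0 < `|a| + 1 by rewrite ltr_wpDl.
have [r r0 {}H] := H (e / (`|a| + 1)) (divr_gt0 e0 c0).
exists r => // y /H {}H; rewrite mulmxBl mul1mx -scalemxAl.
rewrite (_ : _ - _ = - (a *: (F y - F x - A *m (y - x)))); last first.
  by move: (A *m _) => p; apply/matrixP => i j; rewrite !mxE; ring.
rewrite enormN enormZ; apply: le_trans (ler_wpM2l (normr_ge0 _) H) _.
rewrite mulrA ler_wpM2r ?enorm_ge0// mulrCA ler_piMr ?(ltW e0)//.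
by rewrite ler_pdivrMr// mul1r lerDl ler01.
Qed.

End Differentiation.

(** * Strict differentiability, symmetry of second derivatives, product rule *)

Section SecondOrder.
Context {R : realType} {n : nat}.
Implicit Types (u v w x y z d : 'cV[R]_n) (A B : 'M[R]_n) (h : 'cV[R]_n -> R)
  (F : 'cV[R]_n -> 'cV[R]_n) (J : 'cV[R]_n -> 'M[R]_n).

Lemma segment_ball x y z (r t : R) : enorm (y - x) < r -> enorm (z - x) < r ->
  0 <= t <= 1 -> enorm (z + t *: (y - z) - x) < r.
Proof.
move=> yx zx /andP[t0 t1].
have -> : z + t *: (y - z) - x = t *: (y - x) + (1 - t) *: (z - x).
  by apply/matrixP => i j; rewrite !mxE; ring.
apply: le_lt_trans (ler_enormD _ _) _; rewrite !enormZ.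
rewrite ger0_norm// ger0_norm ?subr_ge0//.
have [t0'|t0'] := eqVneq t 0; first by rewrite t0'; lra.
have tp : 0 < t by rewrite lt_def t0'.
have : t * enorm (y - x) < t * r by rewrite ltr_pM2l.
have : (1 - t) * enorm (z - x) <= (1 - t) * r.
  by rewrite ler_wpM2l ?subr_ge0// ltW.
by lra.
Qed.

(** The mean value theorem is applied to the scalar function [dotv w \o F], where [w] is the very
    error to be bounded. This gives [|w|^2 <= |w| (e |y - z|)], and [|w|] cancels. *)
Lemma C1_strict_jac F J x (r : R) : 0 < r ->
  (forall y, enorm (y - x) < r -> hasjac F y (J y)) ->
  {for x, continuous J} -> strict_jac F x (J x).
Proof.
move=> r0 FJ cJ e e0.
have [q q0 small] := @enorm_mulmx_small R n e e0.
have /nbhs_enormP[r1 r10 H1] : \forall y \near x, `|J x - J y| < q.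
  by move: cJ => /cvgrPdist_lt; apply.
exists (Num.min r r1); first by rewrite lt_min r0.
move=> y z; rewrite !lt_min => /andP[yr yr1] /andP[zr zr1].
set w := _ - _ *m _.
have [|c c01] := @hasgrad_mvt _ _ (dotv w \o F) (fun p => (J p)^T *m w) z (y - z).
  move=> t t01; apply: hasgrad_comp (hasgrad_dotvl _ _) _.
  by apply: FJ; exact: segment_ball.
rewrite -dotv_mulmx /= [z + (y - z)]addrC subrK -dotvBr => E.
have /small S : `|J (z + c *: (y - z)) - J x| <= q.
  by rewrite distrC ltW// H1//; exact: segment_ball.
have : dotv w w <= enorm w * (e * enorm (y - z)).
  rewrite {2}/w dotvBr E -dotvBr -mulmxBl.
  by apply: le_trans (dotv_le _ _) _; rewrite ler_wpM2l ?enorm_ge0.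
rewrite -enorm_sqr expr2; have [->|w0] := eqVneq w 0.
  by rewrite enorm0 mulr_ge0 ?enorm_ge0// ltW.
by rewrite ler_pM2l// enorm_gt0.
Qed.

(* The second difference is symmetric in [u] and [v], its first-order
   approximation is not a priori: this yields Schwarz's theorem below. *)
Lemma second_difference h F x A u v (r e : R) : 0 < r -> 0 < e ->
  (forall z, enorm (z - x) < r -> hasgrad h z (F z)) -> hasjac F x A ->
  exists2 q : R, 0 < q & forall s : R, 0 < s -> s < q ->
   `|h (x + s *: u + s *: v) - h (x + s *: u) - h (x + s *: v) + h x
     - s ^+ 2 * dotv (A *m v) u| <= s ^+ 2 * (2 * e * (enorm u + enorm v) ^+ 2).
Proof.
move=> r0 e0 hF /(_ _ e0)[r1 r10 FA].
set M := enorm u + enorm v.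
have M0 : 0 <= M by rewrite addr_ge0 ?enorm_ge0.
have M1 : 0 < M + 1 by rewrite ltr_wpDl.
exists (Num.min r r1 / (M + 1)); first by rewrite divr_gt0// lt_min r0.
move=> s s0; rewrite ltr_pdivlMr// lt_min => /andP[sr sr1].
(* The boolean switches the shift by [s *: v] on or off, so that one bound serves both points at
   which [F] is expanded. *)
have small t (b : bool) : 0 <= t <= 1 ->
    enorm (t *: (s *: u) + b%:R *: (s *: v)) <= s * M.
  move=> /andP[t0 t1]; apply: le_trans (ler_enormD _ _) _; rewrite !enormZ.
  rewrite !ger0_norm ?ler0n ?(ltW s0)// mulrDr lerD//.
    by rewrite ler_piMl// mulr_ge0 ?enorm_ge0// ltW.
  by rewrite ler_piMl ?lern1 ?leq_b1// mulr_ge0 ?enorm_ge0// ltW.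
have ltM : s * M < s * (M + 1) by rewrite ltr_pM2l// ltrDl.
have near t (b : bool) : 0 <= t <= 1 ->
    enorm (x + t *: (s *: u) + b%:R *: (s *: v) - x) < s * (M + 1).
  move=> /(small t b) H; rewrite addrAC [x + _]addrC addrK.
  exact: le_lt_trans ltM.
(* The second difference is the increment along [s *: u] of [h (z + s *: v) - h z], so the mean
   value theorem turns it into a difference of two values of [F]. *)
have [|c c01] := @hasgrad_mvt _ _ (fun z => h (z + s *: v) + (- 1) * h z)
    (fun z => F (z + s *: v) + (- 1) *: F z) x (s *: u).
  move=> t t01; apply: hasgradD; last first.
    apply/hasgradZ/hF; apply: lt_trans sr; have := near t false t01.
    by rewrite scale0r addr0.
  have H : hasgrad h (x + t *: (s *: u) + s *: v) (F (x + t *: (s *: u) + s *: v)).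
    by apply: hF; apply: lt_trans sr; have := near t true t01; rewrite scale1r.
  move=> e' e'0; have [r' r'0 H'] := H _ e'0; exists r' => // y yr.
  have E : y + s *: v - (x + t *: (s *: u) + s *: v) = y - (x + t *: (s *: u)).
    by rewrite opprD addrACA subrr addr0.
  by have := H' (y + s *: v); rewrite E => /(_ yr).
rewrite scaleN1r => E.
rewrite (_ : _ - _ - _ + _ = dotv (F (x + c *: (s *: u) + s *: v) -
    F (x + c *: (s *: u))) (s *: u)); last by rewrite -E; ring.
have := FA (x + c *: (s *: u) + s *: v).
have := near c true c01; rewrite scale1r => N1 /(_ (lt_trans N1 sr1)).
have := FA (x + c *: (s *: u)).
have := near c false c01; rewrite scale0r addr0 => N2 /(_ (lt_trans N2 sr1)).
have := small c true c01; rewrite scale1r.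
have := small c false c01; rewrite scale0r addr0.
rewrite [x + _ - x]addrC addKr -[x + _ + _]addrA [x + _ - x]addrC addKr.
set p := c *: (s *: u); rewrite mulmxDr.
set F1 := F (x + p); set F2 := F (x + _).
set Ap := A *m p; set e1 := F1 - F x - Ap; set e2 := F2 - F x - _.
move=> S1 S2 H1 H2.
have -> : s ^+ 2 * dotv (A *m v) u = dotv (A *m (s *: v)) (s *: u).
  by rewrite -scalemxAr !dotvE; ring.
rewrite -dotvBl (_ : F2 - F1 - _ = e2 - e1); last first.
  by rewrite /e2 /e1; apply/matrixP => i j; rewrite !mxE; ring.
apply: le_trans (cauchy_schwarz _ _) _; rewrite enormZ (gtr0_norm s0).
have uM : enorm u <= M by rewrite lerDl enorm_ge0.
have H : enorm (e2 - e1) <= 2 * e * (s * M).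
  apply: le_trans (ler_enormB _ _) _.
  have := ler_wpM2l (ltW e0) S1; have := ler_wpM2l (ltW e0) S2.
  by move: H1 H2; lra.
have -> : s ^+ 2 * (2 * e * M ^+ 2) = 2 * e * (s * M) * (s * M) by ring.
by rewrite ler_pM ?enorm_ge0 ?mulr_ge0 ?enorm_ge0 ?(ltW s0)// ler_pM2l.
Qed.

Lemma sym_mxP A : (forall u v, dotv (A *m v) u = dotv (A *m u) v) -> A^T = A.
Proof.
move=> H; apply/matrixP => i j; rewrite mxE.
have E k l : dotv (A *m delta_mx k 0) (delta_mx l 0) = A l k.
  rewrite /dotv (bigD1 l)//= big1 ?addr0 => [|q ql]; last first.
    by rewrite [delta_mx _ _ _ _]mxE (negbTE ql) mulr0.
  by rewrite [delta_mx l _ _ _]mxE !eqxx mulr1 -colE mxE.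
by rewrite -E H E.
Qed.

(** Exchanging [u] and [v] leaves the second difference unchanged, so [s ^+ 2 * dotv (A *m v) u] and
    [s ^+ 2 * dotv (A *m u) v] both approximate the same number up to a small multiple of
    [s ^+ 2]. *)
Lemma jac_of_grad_sym h F x A (r : R) : 0 < r ->
  (forall z, enorm (z - x) < r -> hasgrad h z (F z)) -> hasjac F x A -> A^T = A.
Proof.
move=> r0 hF FA; apply: sym_mxP => u v; apply/eqP; rewrite -subr_eq0 -normr_le0.
apply/ler_addgt0Pr => e e0; rewrite add0r.
set M := enorm u + enorm v.
(* Two errors [2 e1 M^2] must add up to at most [e], which explains the factor 4; the added 1 covers
   [u = v = 0]. *)
have M1 : 0 < 4 * (M ^+ 2 + 1) by rewrite mulr_gt0// ltr_wpDl// sqr_ge0.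
have e1 : 0 < e / (4 * (M ^+ 2 + 1)) by rewrite divr_gt0.
have [q q0 H1] := second_difference u v r0 e1 hF FA.
have [p p0 H2] := second_difference v u r0 e1 hF FA.
pose s := Num.min q p / 2; have qp0 : 0 < Num.min q p by rewrite lt_min q0.
have s0 : 0 < s by rewrite divr_gt0.
have : s < Num.min q p by rewrite /s; lra.
rewrite lt_min => /andP[/H1 {}H1 /H2 {}H2].
have {}H1 := H1 s0; have {}H2 := H2 s0.
have s2 : 0 < s ^+ 2 by rewrite exprn_gt0.
rewrite -(ler_pM2l s2) -[s ^+ 2 in leLHS]gtr0_norm// -normrM mulrBr.
move: H1 H2; rewrite [enorm v + _]addrC -/M [x + s *: v + _]addrAC.
move: (h _) (h _) (h _) (h _) => h1 h2 h3 h4.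
rewrite !ler_norml => /andP[a1 a2] /andP[a3 a4].
have Q : s ^+ 2 * (2 * (e / (4 * (M ^+ 2 + 1))) * M ^+ 2) <= s ^+ 2 * (e / 2).
  rewrite ler_pM2l//.
  have -> : 2 * (e / (4 * (M ^+ 2 + 1))) * M ^+ 2 = e / 2 * (M ^+ 2 / (M ^+ 2 + 1)).
    by field; rewrite gt_eqF// ltr_wpDl// sqr_ge0.
  rewrite ler_piMr ?divr_ge0 ?(ltW e0)// ler_pdivrMr ?ltr_wpDl ?sqr_ge0//.
  by rewrite mul1r lerDl ler01.
apply/andP; split; lra.
Qed.

Lemma strict_jac_lip F x A : strict_jac F x A -> exists2 r : R, 0 < r &
  exists2 C : R, 0 < C & forall y z, enorm (y - x) < r -> enorm (z - x) < r ->
    enorm (F y - F z) <= C * enorm (y - z).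
Proof.
move=> /(_ 1 ltr01)[r r0 H]; exists r => //.
exists (1 + n%:R ^+ 2 * `|A|) => [|y z yr zr].
  by rewrite ltr_wpDr// mulr_ge0// exprn_ge0.
rewrite -(subrK (A *m (y - z)) (F y - F z)).
apply: le_trans (ler_enormD _ _) _; rewrite mulrDl lerD// ?enorm_mulmx//.
exact: H.
Qed.

Lemma strict_jac_id_sub (a : R) F x A : strict_jac F x A ->
  strict_jac (fun y => y - a *: F y) x (1%:M - a *: A).
Proof.
move=> H e e0; have c0 : 0 < `|a| + 1 by rewrite ltr_wpDl.
have [r r0 {}H] := H (e / (`|a| + 1)) (divr_gt0 e0 c0).
exists r => // y z yr zr; have {}H := H y z yr zr.
rewrite mulmxBl mul1mx -scalemxAl.
rewrite (_ : _ - _ = - (a *: (F y - F z - A *m (y - z)))); last first.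
  by move: (A *m _) => p; apply/matrixP => i j; rewrite !mxE; ring.
rewrite enormN enormZ; apply: le_trans (ler_wpM2l (normr_ge0 _) H) _.
rewrite mulrA ler_wpM2r ?enorm_ge0// mulrCA ler_piMr ?(ltW e0)//.
by rewrite ler_pdivrMr// mul1r lerDl ler01.
Qed.

Lemma strict_jac_comp F1 F2 x A1 A2 : strict_jac F1 (F2 x) A1 -> strict_jac F2 x A2 ->
  strict_jac (F1 \o F2) x (A1 *m A2).
Proof.
move=> H1 H2 e e0.
have [r r0 [C C0 HC]] := strict_jac_lip H2.
have e2 : 0 < e / 2 / C by rewrite !divr_gt0.
have [r1 r10 {}H1] := H1 _ e2.
pose c : R := n%:R ^+ 2 * `|A1| + 1.
have c0 : 0 < c by rewrite ltr_wpDl// mulr_ge0// exprn_ge0.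
have e3 : 0 < e / 2 / c by rewrite !divr_gt0.
have [r2 r20 {}H2] := H2 _ e3.
exists (Num.min (r1 / C) (Num.min r r2)); first by rewrite !lt_min divr_gt0// r0.
have near y : enorm (y - x) < r -> enorm (y - x) < r1 / C -> enorm (F2 y - F2 x) < r1.
  move=> yr; rewrite ltr_pdivlMr// => /(le_lt_trans _); apply.
  by rewrite mulrC HC// subrr enorm0.
move=> y z; rewrite !lt_min => /and3P[y1 yr y2] /and3P[z1 zr z2].
rewrite -mulmxA /= -(subrK (A1 *m (F2 y - F2 z)) (F1 _ - F1 _)) -addrA -mulmxBr.
apply: le_trans (ler_enormD _ _) _; rewrite (splitr e) mulrDl lerD//.
  apply: le_trans (H1 _ _ (near _ yr y1) (near _ zr z1)) _.
  rewrite -mulrA ler_wpM2l ?divr_ge0 ?(ltW e0)//.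
  by rewrite mulrC ler_pdivrMr// mulrC HC.
apply: le_trans (enorm_mulmx _ _) _.
have cA : n%:R ^+ 2 * `|A1| <= c by rewrite lerDl ler01.
apply: le_trans (ler_pM _ _ cA (H2 _ _ y2 z2)) _; rewrite ?enorm_ge0//.
by rewrite mulrA [c * _]mulrC divfK// gt_eqF.
Qed.

(** A product rule in which [J] is only Lipschitz: since [F] vanishes at [x], variations of [J] are
    multiplied by something small and contribute nothing to first order. *)
Lemma strict_jac_mulmx J F x A (r K : R) : 0 < r ->
  (forall y z u, enorm (y - x) < r -> enorm (z - x) < r ->
     enorm (J y *m u - J z *m u) <= K * enorm (y - z) * enorm u) ->
  strict_jac F x A -> F x = 0 -> strict_jac (fun y => J y *m F y) x (J x *m A).
Proof.
move=> r0 HJ FA Fx e e0.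
have [r1 r10 [C C0 HC]] := strict_jac_lip FA.
pose K' := `|K| + 1; have K'0 : 0 < K' by rewrite ltr_wpDl.
have HK y z u : enorm (y - x) < r -> enorm (z - x) < r ->
    enorm (J y *m u - J z *m u) <= K' * enorm (y - z) * enorm u.
  move=> yr zr; apply: le_trans (HJ y z u yr zr) _.
  rewrite !ler_wpM2r ?enorm_ge0//; apply: le_trans (ler_norm _) _.
  by rewrite lerDl ler01.
pose c : R := n%:R ^+ 2 * `|J x| + 1.
have c0 : 0 < c by rewrite ltr_wpDl// mulr_ge0// exprn_ge0.
have e3 : 0 < e / 2 / c by rewrite !divr_gt0.
have [r2 r20 {}FA] := FA _ e3.
have s0 : 0 < e / (4 * K' * C) by rewrite divr_gt0// !mulr_gt0.
exists (Num.min (e / (4 * K' * C)) (Num.min r (Num.min r1 r2))).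
  by rewrite !lt_min s0 r0 r10.
move=> y z; rewrite !lt_min => /and4P[ys yr y1 y2] /and4P[zs zr z1 z2].
have xx q : 0 < q -> enorm (x - x) < q by rewrite subrr enorm0.
(* Three terms with shares [e / 4], [e / 4], [e / 2]: the change of [J] against the small [F y], the
   change of [J] from [x] to [z], and the linearization error of [F]. *)
rewrite (_ : _ - _ = (J y *m F y - J z *m F y) + ((J z *m (F y - F z) -
   J x *m (F y - F z)) + J x *m (F y - F z - A *m (y - z)))); last first.
  rewrite [J x *m (_ - A *m _)]mulmxBr [J x *m (A *m _)]mulmxA [J z *m (_ - _)]mulmxBr.
  move: (J x *m (_ - _)) (J x *m A *m _) (J y *m _) (J z *m F y) (J z *m _) => a b c' p q.
  by apply/matrixP => i j; rewrite !mxE; ring.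
have Fy : K' * enorm (F y) <= e / 4.
  have := HC _ _ y1 (xx _ r10); rewrite Fx subr0 => /(ler_wpM2l (ltW K'0)).
  move=> /le_trans; apply; rewrite ltr_pdivlMr ?mulr_gt0// in ys; lra.
have T1 := le_trans (HK y z (F y) yr zr)
  (_ : _ <= e / 4 * enorm (y - z)).
have T2 := HK z x (F y - F z) zr (xx _ r0).
have T3 := enorm_mulmx (J x) (F y - F z - A *m (y - z)).
have {}T1 : enorm (J y *m F y - J z *m F y) <= e / 4 * enorm (y - z).
  by apply: T1; rewrite mulrAC ler_wpM2r ?enorm_ge0.
have {}T2 : enorm (J z *m (F y - F z) - J x *m (F y - F z)) <= e / 4 * enorm (y - z).
  apply: le_trans T2 _; rewrite ltr_pdivlMr ?mulr_gt0// in zs.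
  apply: le_trans (_ : _ <= K' * enorm (z - x) * (C * enorm (y - z))) _.
    by rewrite ler_wpM2l ?mulr_ge0 ?enorm_ge0 ?(ltW K'0)// HC.
  rewrite mulrA ler_wpM2r ?enorm_ge0//; lra.
have {}T3 : enorm (J x *m (F y - F z - A *m (y - z))) <= e / 2 * enorm (y - z).
  apply: le_trans T3 _.
  have cA : n%:R ^+ 2 * `|J x| <= c by rewrite lerDl ler01.
  apply: le_trans (ler_pM _ _ cA (FA _ _ y2 z2)) _; rewrite ?enorm_ge0//.
  by rewrite mulrA [c * _]mulrC divfK// gt_eqF.
apply: le_trans (ler_enormD _ _) _.
have := ler_enormD (J z *m (F y - F z) - J x *m (F y - F z))
  (J x *m (F y - F z - A *m (y - z))).
by move: T1 T2 T3; lra.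
Qed.

(** * Continuity of matrix fields and Clarke Jacobians *)

Definition op_continuous J x := forall e : R, 0 < e -> exists2 r : R, 0 < r &
  forall y u, enorm (y - x) < r -> enorm (J y *m u - J x *m u) <= e * enorm u.

Lemma continuous_op J x : {for x, continuous J} -> op_continuous J x.
Proof.
move=> cJ e e0; have [q q0 small] := @enorm_mulmx_small R n e e0.
have /nbhs_enormP[r r0 H] : \forall y \near x, `|J x - J y| < q.
  by move: cJ => /cvgrPdist_lt; apply.
by exists r => // y u /H yx; rewrite -mulmxBl small// distrC ltW.
Qed.

Lemma op_continuous_comp J F x (C : R) : op_continuous J (F x) ->
  (forall y, enorm (F y - F x) <= C * enorm (y - x)) -> op_continuous (J \o F) x.
Proof.
move=> HJ HF e /HJ[r r0 {}HJ]; have C1 : 0 < `|C| + 1 by rewrite ltr_wpDl.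
exists (r / (`|C| + 1)); first by rewrite divr_gt0.
move=> y u; rewrite ltr_pdivlMr// mulrC => yr; apply: HJ.
apply: le_lt_trans yr; apply: le_trans (HF y) _.
rewrite ler_wpM2r ?enorm_ge0//; apply: le_trans (ler_norm _) _.
by rewrite lerDl ler01.
Qed.

Lemma op_continuous_cst A x : op_continuous (fun=> A) x.
Proof.
move=> e e0; exists 1 => // y u _.
by rewrite subrr enorm0 mulr_ge0 ?enorm_ge0// ltW.
Qed.

Lemma op_continuousB J1 J2 x : op_continuous J1 x -> op_continuous J2 x ->
  op_continuous (fun y => J1 y - J2 y) x.
Proof.
move=> H1 H2 e e0; have e2 : 0 < e / 2 by rewrite divr_gt0.
have [r1 r10 {}H1] := H1 _ e2; have [r2 r20 {}H2] := H2 _ e2.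
exists (Num.min r1 r2); first by rewrite lt_min r10.
move=> y u; rewrite lt_min => /andP[/(H1 y u) {}H1 /(H2 y u) {}H2].
rewrite (_ : _ - _ = (J1 y *m u - J1 x *m u) - (J2 y *m u - J2 x *m u)).
  by apply: le_trans (ler_enormB _ _) _; lra.
rewrite !mulmxBl; move: (J1 y *m u) (J1 x *m u) (J2 y *m u) (J2 x *m u) => p q s t.
by apply/matrixP => i j; rewrite !mxE; ring.
Qed.

Lemma op_continuous_mulmx J1 J2 x : op_continuous J1 x -> op_continuous J2 x ->
  op_continuous (fun y => J1 y *m J2 y) x.
Proof.
move=> H1 H2 e e0.
pose c1 : R := n%:R ^+ 2 * `|J1 x| + 1; pose c2 : R := n%:R ^+ 2 * `|J2 x| + 1.
have c10 : 0 < c1 by rewrite ltr_wpDl// mulr_ge0// exprn_ge0.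
have c20 : 0 < c2 by rewrite ltr_wpDl// mulr_ge0// exprn_ge0.
have [r1 r10 B1] := H1 1 ltr01.
have e1 : 0 < e / 2 / c2 by rewrite !divr_gt0.
have e2 : 0 < e / 2 / c1 by rewrite !divr_gt0.
have [r2 r20 {}H1] := H1 _ e1; have [r3 r30 {}H2] := H2 _ e2.
exists (Num.min r1 (Num.min r2 r3)); first by rewrite !lt_min r10 r20.
move=> y u; rewrite !lt_min => /and3P[y1 y2 y3].
rewrite (_ : _ - _ = J1 y *m (J2 y *m u - J2 x *m u) +
  (J1 y *m (J2 x *m u) - J1 x *m (J2 x *m u))); last first.
  by rewrite mulmxBr -!mulmxA addrA subrK.
have N1 v : enorm (J1 y *m v) <= c1 * enorm v.
  rewrite -(subrK (J1 x *m v) (J1 y *m v)); apply: le_trans (ler_enormD _ _) _.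
  by rewrite mulrDl addrC lerD ?enorm_mulmx// B1.
apply: le_trans (ler_enormD _ _) _; rewrite (splitr e) mulrDl lerD//.
  apply: le_trans (N1 _) _; apply: le_trans (ler_wpM2l (ltW c10) (H2 _ _ y3)) _.
  by rewrite mulrA [c1 * _]mulrC divfK// gt_eqF.
apply: le_trans (H1 _ _ y2) _; rewrite -mulrA ler_wpM2l ?divr_ge0 ?(ltW e0)//.
rewrite mulrC ler_pdivrMr// mulrC; apply: le_trans (enorm_mulmx _ _) _.
by rewrite ler_wpM2r ?enorm_ge0// lerDl ler01.
Qed.

Lemma op_continuousZ (a : R) J x : op_continuous J x ->
  op_continuous (fun y => a *: J y) x.
Proof.
move=> HJ e e0; have c0 : 0 < `|a| + 1 by rewrite ltr_wpDl.
have [r r0 {}HJ] := HJ (e / (`|a| + 1)) (divr_gt0 e0 c0).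
exists r => // y u /(HJ y u) {}HJ; rewrite -!scalemxAl -scalerBr enormZ.
apply: le_trans (ler_wpM2l (normr_ge0 _) HJ) _.
rewrite mulrA ler_wpM2r ?enorm_ge0// mulrCA ler_piMr ?(ltW e0)//.
by rewrite ler_pdivrMr// mul1r lerDl ler01.
Qed.

(** The columns of the Jacobian are the differentials along the basis vectors; finitely many
    neighbourhoods are intersected. *)
Lemma jac_continuous F x : (forall v, {for x, continuous (fun z => 'd F z v)}) ->
  {for x, continuous (jac F)}.
Proof.
move=> H; apply/(@cvgrPdist_lt _ _ _ (nbhs x)) => e e0.
have e2 : 0 < e / 2 by rewrite divr_gt0.
have /filter_forall : forall j : 'I_n, \forall y \near x,
    `|'d F x (delta_mx j 0 : 'cV[R]_n) - 'd F y (delta_mx j 0 : 'cV[R]_n)| < e / 2.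
  by move=> j; move: (H (delta_mx j 0)) => /cvgrPdist_lt; apply.
apply: filterS => y Hy; apply: (@le_lt_trans _ _ (e / 2)); last by lra.
apply: norm_le_entry => [|i j]; first exact: ltW.
rewrite !mxE; apply: le_trans (ltW (Hy j)).
have := entry_le_norm
  ('d F x (delta_mx j 0 : 'cV[R]_n) - 'd F y (delta_mx j 0 : 'cV[R]_n)) i 0.
by rewrite !mxE.
Qed.

(** By continuity every limit of nearby Jacobians is [jac F x], and a convex combination of copies
    of one matrix is that matrix. *)
Lemma clarke_C1 F x A : {for x, continuous (jac F)} -> clarke F x A -> A = jac F x.
Proof.
move=> cJ [k [w [M [_ [w1 [SM ->]]]]]].
have MJ i : M i = jac F x.
  have [y [yx [_ yM]]] := SM i.
  exact: (cvg_unique _ yM (cvg_comp _ _ yx cJ)).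
by under eq_bigr do rewrite MJ; rewrite -scaler_suml w1 scale1r.
Qed.

End SecondOrder.

(** * Proximal map and forward-backward envelope *)

Section ForwardBackwardEnvelope.
Context {R : realType} {n : nat}.
Variables (f : 'cV[R]_n -> R) (g : 'cV[R]_n -> \bar R) (Lf rho gamma : R).
Implicit Types (u v w x y z d p : 'cV[R]_n) (A B : 'M[R]_n).

Hypothesis Lf_gt0 : 0 < Lf.
Hypothesis rho_gt0 : 0 < rho.
Hypothesis gamma_gt0 : 0 < gamma.
Hypothesis gammaLf : gamma < Lf^-1.
Hypothesis gammarho : gamma < rho^-1.
Hypothesis df : forall x, hasgrad f x (grad f x).
Hypothesis gradLip : forall x y, enorm (grad f x - grad f y) <= Lf * enorm (x - y).
Hypothesis gproper : proper_fun g.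
Hypothesis glsc : lower_semicontinuous g.
Hypothesis gwc : weakly_convex rho g.
Hypothesis phimin : exists z, forall x, ((f z)%:E + g z <= (f x)%:E + g x)%E.

(** [taylor_mvt] with [q = Lf |d|^2]: the Lipschitz bound on the gradient makes the right-hand side
    nonpositive. *)
Lemma descent x d : f (x + d) <= f x + dotv (grad f x) d + Lf / 2 * enorm d ^+ 2.
Proof.
have [//|c /andP[c0 _] E] := @taylor_mvt _ _ f (grad f) x d (Lf * enorm d ^+ 2).
have : dotv (grad f (x + c *: d) - grad f x) d <= c * (Lf * enorm d ^+ 2).
  apply: le_trans (dotv_le _ _) _.
  apply: le_trans (ler_wpM2r (enorm_ge0 _) (gradLip _ _)) _.
  rewrite [x + _]addrC addrK enormZ ger0_norm// le_eqVlt; apply/orP; left.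
  by apply/eqP; ring.
by move: E; lra.
Qed.

Lemma gfin_or_infty w : (exists a : R, g w = a%:E) \/ g w = +oo%E.
Proof.
by have := gproper.1 w; case: (g w) => [a _|_|//]; [left; exists a|right].
Qed.

Let k : R := 1 / (2 * gamma).
(** The strong convexity modulus of the prox objective [g + k |. - y|^2]. *)
Let sigma : R := gamma^-1 - rho.

Let k_gt0 : 0 < k. Proof. by rewrite divr_gt0// mulr_gt0. Qed.

Let sigma_gt0 : 0 < sigma.
Proof. by rewrite subr_gt0 -[rho]invrK ltf_pV2 // posrE invr_gt0. Qed.

Let kLf : 0 < k - Lf / 2.
Proof.
have : Lf < gamma^-1 by rewrite -[Lf]invrK ltf_pV2 // posrE invr_gt0.
by rewrite /k div1r invfM; lra.
Qed.

Let ksigma : k = sigma / 2 + rho / 2.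
Proof. by rewrite /k /sigma; field; rewrite gt_eqF. Qed.

(** Convexity of [g + rho / 2 |.|^2] at [t = 1/2]; the parallelogram identity collects the quadratic
    terms. Convexity of [g] enters below only through this inequality. *)
Lemma weakly_convex_midpoint w w' (a b : R) : g w = a%:E -> g w' = b%:E ->
  (g (2^-1 *: (w + w')) <= (a / 2 + b / 2 + rho / 8 * enorm (w - w') ^+ 2)%:E)%E.
Proof.
move=> ga gb; have h2 : 0 < (2^-1 : R) < 1 by apply/andP; split; lra.
have := gwc w w' h2; rewrite ga gb.
have -> : 1 - 2^-1 = 2^-1 :> R by lra.
rewrite -scalerDr -!EFinD -leeBrDr// -EFinB => /le_trans; apply.
rewrite lee_fin !enorm_sqr !dotvE (dotvC w' w) le_eqVlt; apply/orP; left.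
by apply/eqP; field.
Qed.

(** A minimizer of [f + g] bounds [g] below by a constant minus [f], and [descent] bounds [f] above
    by a quadratic with leading coefficient [Lf / 2 < k]. Completing the square in [|w - y|] gives
    the constant. *)
Lemma prox_objective_lb y : exists m0 : R, forall w,
  (m0%:E <= g w + (k * enorm (w - y) ^+ 2)%:E)%E.
Proof.
have [z zmin] := phimin; have [w0 gw0] := gproper.2.
have [[a ga]|ga] := gfin_or_infty z; last first.
  have [[b gb]|gb] := gfin_or_infty w0; last by rewrite gb in gw0.
  by have := zmin w0; rewrite ga gb.
pose b := k - Lf / 2; pose c := enorm (grad f y).
exists (f z + a - f y - c ^+ 2 / (4 * b)) => w.
have [[r gr]|->] := gfin_or_infty w; last by rewrite addye ?leey.
have := zmin w; rewrite ga gr -!EFinD !lee_fin => H.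
have := descent y (w - y); rewrite [y + _]addrC subrK => D.
have := dotv_le (grad f y) (w - y); rewrite -/c.
set t := enorm (w - y) in D *; move=> C.
have : 0 <= b * (t - c / (2 * b)) ^+ 2 by rewrite mulr_ge0 ?sqr_ge0// ltW.
have -> : b * (t - c / (2 * b)) ^+ 2 = b * t ^+ 2 - c * t + c ^+ 2 / (4 * b).
  by field; rewrite gt_eqF.
have -> : k = b + Lf / 2 by rewrite /b subrK.
by rewrite [(b + _) * _]mulrDl; lra.
Qed.

(* The objective is midpoint strongly convex, so a minimizing sequence is
   Cauchy. *)
Lemma prox_exists y : exists z, is_prox gamma g y z.
Proof.
pose H w : \bar R := (g w + (k * enorm (w - y) ^+ 2)%:E)%E.
pose S := [set r : R | exists w, H w = r%:E].
have [m0 m0H] := prox_objective_lb y.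
have [w0 gw0] := gproper.2.
have [[a0 ga0]|ga0] := gfin_or_infty w0; last by rewrite ga0 in gw0.
have Slb : has_lbound S.
  by exists m0 => r [w Hw]; rewrite -lee_fin -Hw; exact: m0H.
have Sinf : has_inf S.
  by split => //; exists (a0 + k * enorm (w0 - y) ^+ 2), w0; rewrite /H ga0.
pose m := inf S.
have mH w : (m%:E <= H w)%E.
  have [[a ga]|ga] := gfin_or_infty w; last by rewrite /H ga addye ?leey.
  rewrite /H ga -EFinD lee_fin; apply: ge_inf => //.
  by exists w; rewrite /H ga.
have approx e : 0 < e -> exists w, exists2 a : R, g w = a%:E &
    a + k * enorm (w - y) ^+ 2 < m + e.
  move=> e0; have [r [w Hw] rm] := inf_adherent e0 Sinf.
  exists w; have [[a ga]|ga] := gfin_or_infty w; last by rewrite /H ga in Hw.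
  by exists a => //; move: Hw; rewrite /H ga -EFinD => -[->].
(* The midpoint of two points with values below [m + e] has value at least [m], which leaves room
   for a gap of at most [e]. *)
have close e w w' (a b : R) : g w = a%:E -> g w' = b%:E ->
    a + k * enorm (w - y) ^+ 2 < m + e -> b + k * enorm (w' - y) ^+ 2 < m + e ->
    sigma / 8 * enorm (w - w') ^+ 2 < e.
  move=> ga gb Ha Hb.
  have G := weakly_convex_midpoint ga gb.
  have := le_trans (mH (2^-1 *: (w + w'))) (leeD2r _ G).
  rewrite -EFinD lee_fin => M.
  have E : k * enorm (2^-1 *: (w + w') - y) ^+ 2 =
      k * enorm (w - y) ^+ 2 / 2 + k * enorm (w' - y) ^+ 2 / 2
      - k / 4 * enorm (w - w') ^+ 2.
    by rewrite !enorm_sqr !dotvE (dotvC w' w) (dotvC w y) (dotvC w' y); field.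
  have : k / 4 * enorm (w - w') ^+ 2 =
      sigma / 8 * enorm (w - w') ^+ 2 + rho / 8 * enorm (w - w') ^+ 2.
    by rewrite ksigma; field.
  by lra.
have /choice[ws wsP] : forall j : nat, exists w, exists2 a : R, g w = a%:E &
    a + k * enorm (w - y) ^+ 2 < m + j.+1%:R^-1.
  by move=> j; apply: approx; rewrite invr_gt0.
have inv_small (e : R) : 0 < e -> exists N : nat, forall j, (N <= j)%N -> j.+1%:R^-1 < e.
  move=> e0; exists (Num.truncn e^-1) => j Nj.
  rewrite -[e]invrK ltf_pV2 ?posrE ?invr_gt0//.
  by apply: lt_le_trans (truncnS_gt _) _; rewrite ler_nat.
have cws : cvg (ws @ \oo).
  apply: cauchy_cvg; apply/cauchyP => e e0.
  have [|N HN] := inv_small (sigma / 8 * e ^+ 2).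
    by rewrite mulr_gt0 ?exprn_gt0// divr_gt0.
  exists (ws N), N => // j /= Nj; rewrite -ball_normE /=.
  apply: le_lt_trans (norm_le_enorm _) _.
  have [a ga Ha] := wsP N; have [b gb Hb] := wsP j.
  have := close _ _ _ _ _ ga gb (lt_trans Ha _) (lt_trans Hb _).
  move=> /(_ (sigma / 8 * e ^+ 2)); rewrite !ltrD2l !HN// => /(_ isT isT).
  by rewrite ltr_pM2l ?divr_gt0// ltr_pXn2r ?nnegrE ?enorm_ge0 ?ltW.
pose z : 'cV[R]_n := lim (ws @ \oo).
have zlim := cvg_enormP ws z; have {}zlim := zlim.1 cws.
suff key (e : R) : 0 < e -> (H z <= (m + e)%:E)%E.
  exists z => w; apply: le_trans (mH w); apply/lee_addgt0Pr => e /key.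
  by rewrite EFinD.
(* Otherwise lower semicontinuity keeps [g] above [m + e - k |z - y|^2] near [z], which contradicts
   the values of [ws] far out in the sequence. *)
move=> e0; rewrite leNgt; apply/negP => Hz.
have Hz' : ((m + e - k * enorm (z - y) ^+ 2)%:E < g z)%E.
  by rewrite EFinB lteBlDr.
have [V Vz HV] := glsc Hz'.
have [r r0 Vr] := (nbhs_enormP z V).1 Vz.
have e2 : 0 < e / 4 by rewrite divr_gt0.
have [N1 HN1] := inv_small _ e2.
(* Bounds [|z - y| + |ws j - y|] when [ws j] is closer to [y] than [z] is, the only case in which
   the estimate of the squares below is not trivial. *)
pose c := 2 * enorm (z - y) + 1.
have c0 : 0 < k * c by rewrite mulr_gt0// /c ltr_wpDl// mulr_ge0 ?enorm_ge0.
have r1 : 0 < Num.min r (e / 4 / (k * c)) by rewrite lt_min r0 divr_gt0.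
have [N2 HN2] := zlim _ r1.
have := HN2 _ (leq_maxr N1 N2).
set j := maxn N1 N2; rewrite lt_min => /andP[jr jc].
have [a ga Ha] := wsP j; have Hj := HN1 _ (leq_maxl N1 N2).
have := HV _ (Vr _ jr); rewrite ga lte_fin => Hlow.
have T : enorm (z - y) <= enorm (ws j - z) + enorm (ws j - y).
  by rewrite (enormB (ws j) z); exact: ler_enorm_distD.
have D : k * enorm (z - y) ^+ 2 - k * enorm (ws j - y) ^+ 2 <= e / 4.
  rewrite -mulrBr subr_sqr mulrC.
  have [L|L] := leP (enorm (z - y)) (enorm (ws j - y)).
    apply: le_trans (ltW e2); rewrite -mulrA mulr_le0_ge0 ?subr_le0//.
    by rewrite mulr_ge0 ?addr_ge0 ?enorm_ge0// ltW.
  rewrite ltr_pdivlMr// in jc; apply: le_trans (ltW jc).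
  rewrite -mulrA ler_pM ?subr_ge0 ?(ltW L)//; last 2 first.
    by lra.
    rewrite mulrC ler_wpM2l ?(ltW k_gt0)// /c; lra.
  by rewrite mulr_ge0 ?addr_ge0 ?enorm_ge0// ltW.
have : a + k * enorm (ws j - y) ^+ 2 < m + e / 4.
  by apply: lt_trans Ha _; rewrite ltrD2l.
by lra.
Qed.

Lemma is_prox_prox y : is_prox gamma g y (prox gamma g y).
Proof. exact: (xgetPex 0 (prox_exists y)). Qed.

Lemma is_prox_fin y z : is_prox gamma g y z -> g z = (fine (g z))%:E.
Proof.
move=> zP; have [[a ->]//|gz] := gfin_or_infty z.
have [w0 gw0] := gproper.2.
have [[a0 ga0]|ga0] := gfin_or_infty w0; last by rewrite ga0 in gw0.
by have := zP w0; rewrite gz ga0.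
Qed.

(** The minimizer is compared with the midpoint of [w] and [z]. This yields [sigma / 4], half the
    sharp constant. *)
Lemma prox_growth y z w (a : R) : is_prox gamma g y z -> g w = a%:E ->
  fine (g z) + k * enorm (z - y) ^+ 2 + sigma / 4 * enorm (w - z) ^+ 2
  <= a + k * enorm (w - y) ^+ 2.
Proof.
move=> zP ga; have gz := is_prox_fin zP.
have G := weakly_convex_midpoint ga gz.
have := le_trans (zP (2^-1 *: (w + z))) (leeD2r _ G).
rewrite gz -!EFinD lee_fin -/k => M.
have E : k * enorm (2^-1 *: (w + z) - y) ^+ 2 =
    k * enorm (w - y) ^+ 2 / 2 + k * enorm (z - y) ^+ 2 / 2
    - k / 4 * enorm (w - z) ^+ 2.
  by rewrite !enorm_sqr !dotvE (dotvC z w) (dotvC w y) (dotvC z y); field.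
have : k / 4 * enorm (w - z) ^+ 2 =
    sigma / 8 * enorm (w - z) ^+ 2 + rho / 8 * enorm (w - z) ^+ 2.
  by rewrite ksigma; field.
by move: M; rewrite E /=; lra.
Qed.

Lemma is_prox_unique y z : is_prox gamma g y z -> z = prox gamma g y.
Proof.
move=> zP; have pP := is_prox_prox y.
have G1 := prox_growth pP (is_prox_fin zP); have G2 := prox_growth zP (is_prox_fin pP).
apply/eqP; rewrite -subr_eq0; apply/eqP/enorm_eq0/eqP.
rewrite -sqrf_eq0 eq_le sqr_ge0 andbT.
have s0 : 0 < sigma / 4 by rewrite divr_gt0.
rewrite -(ler_pM2l s0) mulr0; move: G1 G2; rewrite (enormB z (prox _ _ _)).
by have := mulr_ge0 (ltW s0) (sqr_ge0 (enorm (prox gamma g y - z))); lra.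
Qed.

(** Adding the growth inequalities of both prox points, each tested at the other, cancels the values
    of [g] and leaves [sigma / 2 |p - q|^2 <= gamma^-1 dotv (y - y') (p - q)]. *)
Lemma prox_lipschitz : exists2 C : R, 0 < C & forall y y',
  enorm (prox gamma g y - prox gamma g y') <= C * enorm (y - y').
Proof.
have s0 : 0 < gamma * sigma / 2 by rewrite divr_gt0// mulr_gt0.
exists (gamma * sigma / 2)^-1 => [|y y']; first by rewrite invr_gt0.
have pP := is_prox_prox y; have qP := is_prox_prox y'.
have := prox_growth pP (is_prox_fin qP); have := prox_growth qP (is_prox_fin pP).
move: (prox gamma g y) (prox gamma g y') {pP qP} => p q.
rewrite (enormB q p) => G1 G2.
have E : k * enorm (q - y) ^+ 2 - k * enorm (p - y) ^+ 2 + k * enorm (p - y') ^+ 2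
    - k * enorm (q - y') ^+ 2 = gamma^-1 * dotv (y - y') (p - q).
  rewrite !enorm_sqr !dotvE (dotvC q y) (dotvC p y) (dotvC q y') (dotvC p y') /k.
  by field; rewrite gt_eqF.
have D := dotv_le (y - y') (p - q).
have : gamma * (sigma / 2 * enorm (p - q) ^+ 2) <= dotv (y - y') (p - q).
  by rewrite mulrC -ler_pdivlMr// mulrC; lra.
rewrite mulrA mulrA => /le_trans/(_ D).
have [->|pq] := eqVneq (p - q) 0.
  by rewrite enorm0 mulr_ge0 ?enorm_ge0// invr_ge0 ltW.
rewrite expr2 mulrA ler_pM2r ?enorm_gt0// => H.
by rewrite mulrC ler_pdivlMr// mulrC.
Qed.

(** * Smoothness of the Moreau and forward-backward envelopes *)

Definition moreau y : R :=
  fine (g (prox gamma g y)) + k * enorm (prox gamma g y - y) ^+ 2.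

(** Each prox point is a competitor at the other base point, which bounds the increment of [moreau]
    on both sides. Both bounds have the same linear part, and the Lipschitz continuity of [prox]
    makes the rest [O(|y' - y|^2)]. *)
Lemma moreau_grad y : hasgrad moreau y (gamma^-1 *: (y - prox gamma g y)).
Proof.
have [C C0 LC] := prox_lipschitz; pose K := k + gamma^-1 * C.
have K0 : 0 < K by rewrite addr_gt0// mulr_gt0// invr_gt0.
move=> e e0; exists (e / K); first by rewrite divr_gt0.
move=> y' y'y; apply: (@le_trans _ _ (K * enorm (y' - y) ^+ 2)); last first.
  rewrite expr2 mulrA ler_wpM2r ?enorm_ge0// mulrC -ler_pdivlMr//.
  exact: ltW.
have pP := is_prox_prox y; have qP := is_prox_prox y'.
have := pP (prox gamma g y'); have := qP (prox gamma g y).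
have gp := is_prox_fin pP; have gq := is_prox_fin qP.
rewrite gp gq -!EFinD !lee_fin -/k /moreau.
have := LC y' y; move: (prox gamma g y) (prox gamma g y') {pP qP LC gp gq} => p q.
move: (fine _) (fine _) => a b L H1 H2.
have E1 : k * enorm (p - y') ^+ 2 - k * enorm (p - y) ^+ 2 =
    dotv (gamma^-1 *: (y - p)) (y' - y) + k * enorm (y' - y) ^+ 2.
  rewrite !enorm_sqr !dotvE (dotvC p y) (dotvC p y') (dotvC y' y) /k.
  by field; rewrite gt_eqF.
have E2 : k * enorm (q - y') ^+ 2 - k * enorm (q - y) ^+ 2 =
    dotv (gamma^-1 *: (y - p)) (y' - y) + k * enorm (y' - y) ^+ 2
    - gamma^-1 * dotv (q - p) (y' - y).
  rewrite !enorm_sqr !dotvE (dotvC p y) (dotvC p y') (dotvC y' y)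
    (dotvC q y) (dotvC q y') /k.
  by field; rewrite gt_eqF.
have D : gamma^-1 * dotv (q - p) (y' - y) <= gamma^-1 * C * enorm (y' - y) ^+ 2.
  rewrite -mulrA ler_pM2l ?invr_gt0//; apply: le_trans (dotv_le _ _) _.
  by rewrite expr2 mulrA ler_wpM2r ?enorm_ge0.
have k2 : 0 <= k * enorm (y' - y) ^+ 2 by rewrite mulr_ge0 ?sqr_ge0// ltW.
have C2 : 0 <= gamma^-1 * C * enorm (y' - y) ^+ 2.
  by apply: mulr_ge0 (sqr_ge0 _); apply: mulr_ge0; rewrite ?invr_ge0 ltW.
rewrite /K mulrDl ler_norml; apply/andP; split; lra.
Qed.

(* [prox] is the gradient of [1/2 |.|^2 - gamma moreau]. *)
Lemma prox_jac_sym y A : hasjac (prox gamma g) y A -> A^T = A.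
Proof.
move=> pA; apply: (@jac_of_grad_sym _ _
  (fun z => 2^-1 * dotv z z + (- gamma) * moreau z) (prox gamma g) y A 1) => // z _.
have -> : prox gamma g z =
    2^-1 *: (2 *: z) + (- gamma) *: (gamma^-1 *: (z - prox gamma g z)).
  move: (prox _ _ _) => p; apply/matrixP => i j; rewrite !mxE.
  by field; rewrite gt_eqF.
exact: hasgradD (hasgradZ _ (hasgrad_dotvv _)) (hasgradZ _ (moreau_grad _)).
Qed.

Local Notation y_ x := (x - gamma *: grad f x).

(** Completing the square in [u] recentres the quadratic at the forward point. The infimum is
    attained at the prox point, where [g] is finite, so [fine] loses nothing. *)
Lemma fbe_moreau x :
  fbe f g gamma x = f x + (- (gamma / 2)) * dotv (grad f x) (grad f x) + moreau (y_ x).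
Proof.
have E u a : f x + dotv (grad f x) (u - x) + k * enorm (u - x) ^+ 2 + a =
    f x + (- (gamma / 2)) * dotv (grad f x) (grad f x) +
    (a + k * enorm (u - y_ x) ^+ 2).
  rewrite !enorm_sqr !dotvE (dotvC u (grad f x)) (dotvC x (grad f x)) (dotvC u x) /k.
  by field; rewrite gt_eqF.
have pP := is_prox_prox (y_ x); have gp := is_prox_fin pP.
rewrite /fbe -[RHS]/(fine (_%:E)); congr fine.
apply/eqP; rewrite eq_le; apply/andP; split.
  apply: ereal_inf_lbound; exists (prox gamma g (y_ x)) => //.
  by rewrite gp -EFinD -/k E /moreau gp.
apply/ereal_infP => _ [u _ <-].
have [[a ga]|->] := gfin_or_infty u; last by rewrite addey ?leey.
rewrite ga -EFinD lee_fin -/k E lerD2l.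
by have := pP u; rewrite gp ga -!EFinD lee_fin.
Qed.

Lemma fbe_Tg x : fbe f g gamma x =
  f x + dotv (grad f x) (Tg f g gamma x - x) + k * enorm (Tg f g gamma x - x) ^+ 2
  + fine (g (Tg f g gamma x)).
Proof.
rewrite fbe_moreau /moreau -/(Tg f g gamma x); move: (Tg _ _ _ _) => u.
rewrite !enorm_sqr !dotvE (dotvC u (grad f x)) (dotvC x (grad f x)) (dotvC u x) /k.
by field; rewrite gt_eqF.
Qed.

Lemma fbe_ge x : f (Tg f g gamma x) + fine (g (Tg f g gamma x)) +
  (k - Lf / 2) * enorm (Tg f g gamma x - x) ^+ 2 <= fbe f g gamma x.
Proof.
rewrite fbe_Tg; have := descent x (Tg f g gamma x - x).
by rewrite [x + _]addrC subrK mulrBl; lra.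
Qed.

(** Differentiate [fbe_moreau] by the chain rule. Symmetry of [A] removes the transposes, and the
    terms in [grad f x] cancel. *)
Lemma fbe_hasgrad x A : hasjac (grad f) x A ->
  hasgrad (fbe f g gamma) x ((1%:M - gamma *: A) *m Rg f g gamma x).
Proof.
move=> fA; have As : A^T = A.
  by apply: (@jac_of_grad_sym _ _ f (grad f) x A 1) => // z _; exact: df.
rewrite (funext fbe_moreau).
have -> : (1%:M - gamma *: A) *m Rg f g gamma x =
    grad f x + (- (gamma / 2)) *: (A^T *m (2 *: grad f x)) +
    (1%:M - gamma *: A)^T *m (gamma^-1 *: (y_ x - prox gamma g (y_ x))).
  have -> : (1%:M - gamma *: A)^T = 1%:M - gamma *: A.
    by rewrite linearB linearZ /= trmx1 As.
  rewrite As /Rg /Tg !mulmxBl !mul1mx -!scalemxAl -!scalemxAr.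
  rewrite !mulmxBr -!scalemxAr.
  move: (prox _ _ _) (A *m x) (A *m grad f x) => p q s.
  move: (A *m p) => t; apply/matrixP => i j; rewrite !mxE.
  by field; rewrite gt_eqF.
apply: hasgradD; first apply: hasgradD => //.
  by apply: hasgradZ; exact: (hasgrad_comp (hasgrad_dotvv _) fA).
by apply: (hasgrad_comp (moreau_grad _)); exact: hasjac_id_sub.
Qed.

Lemma Tg_fixed xs : is_prox gamma g (y_ xs) xs -> Tg f g gamma xs = xs.
Proof. by move=> /is_prox_unique. Qed.

Lemma forward_lipschitz x y :
  enorm (y_ x - y_ y) <= (1 + gamma * Lf) * enorm (x - y).
Proof.
rewrite (_ : _ - _ = (x - y) - gamma *: (grad f x - grad f y)); last first.
  by move: (grad f x) (grad f y) => a b; apply/matrixP => i j; rewrite !mxE; ring.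
apply: le_trans (ler_enormB _ _) _; rewrite mulrDl mul1r lerD2l enormZ gtr0_norm//.
by rewrite -mulrA ler_pM2l.
Qed.

Lemma Tg_lipschitz : exists2 C : R, 0 < C & forall x y,
  enorm (Tg f g gamma x - Tg f g gamma y) <= C * enorm (x - y).
Proof.
have [C C0 H] := prox_lipschitz.
have c0 : 0 < 1 + gamma * Lf by rewrite addr_gt0// mulr_gt0.
exists (C * (1 + gamma * Lf)) => [|x y]; first exact: mulr_gt0.
apply: le_trans (H _ _) _; rewrite -mulrA ler_pM2l//; exact: forward_lipschitz.
Qed.

Lemma fbe_growth xs (c eps : R) : is_prox gamma g (y_ xs) xs -> 0 < c -> 0 < eps ->
  (forall x, enorm (x - xs) < eps ->
    ((f x)%:E + g x >= (f xs)%:E + g xs + (c * enorm (x - xs) ^+ 2)%:E)%E) ->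
  exists2 c0 : R, 0 < c0 & exists2 r : R, 0 < r & forall y, enorm (y - xs) < r ->
    fbe f g gamma xs + c0 * enorm (y - xs) ^+ 2 <= fbe f g gamma y.
Proof.
move=> xsP c_gt0 eps0 H; have Txs := Tg_fixed xsP.
have gxs := is_prox_fin xsP.
have [C C0 TC] := Tg_lipschitz.
(* With [T] the forward-backward point of [y], the strong minimum controls [|T - xs|^2] and the
   descent gap controls [|T - y|^2]. The bound [|y - xs|^2 <= 2 |T - xs|^2 + 2 |T - y|^2] costs the
   factor 2. *)
pose m := Num.min c (k - Lf / 2).
have m0 : 0 < m by rewrite lt_min c_gt0.
exists (m / 2); first by rewrite divr_gt0.
(* The forward-backward map fixes [xs] and is [C]-Lipschitz, so it sends this ball into the one
   where the strong minimum is available. *)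
exists (eps / C) => [|y]; first exact: divr_gt0.
rewrite ltr_pdivlMr// mulrC => yeps.
have := fbe_ge y; have := TC y xs; rewrite Txs.
have gT : g (Tg f g gamma y) = (fine (g (Tg f g gamma y)))%:E.
  by apply: is_prox_fin; exact: is_prox_prox (y_ y).
move: gT; set T := Tg f g gamma y => gT TC' Fge.
have := H T (le_lt_trans TC' yeps); rewrite gT gxs -!EFinD lee_fin => HT.
have -> : fbe f g gamma xs = f xs + fine (g xs).
  by rewrite fbe_Tg Txs subrr dotv0r enorm0; ring.
have D : enorm (y - xs) ^+ 2 <= 2 * enorm (T - xs) ^+ 2 + 2 * enorm (T - y) ^+ 2.
  have : enorm (y - xs) ^+ 2 <= (enorm (T - xs) + enorm (T - y)) ^+ 2.
    rewrite ler_pXn2r ?nnegrE ?addr_ge0 ?enorm_ge0//.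
    by rewrite [leRHS]addrC (enormB T y) ler_enorm_distD.
  have := sqr_ge0 (enorm (T - xs) - enorm (T - y)).
  by rewrite sqrrB sqrrD; lra.
have M1 : m * enorm (T - xs) ^+ 2 <= c * enorm (T - xs) ^+ 2.
  by rewrite ler_wpM2r ?sqr_ge0// ge_min lexx.
have M2 : m * enorm (T - y) ^+ 2 <= (k - Lf / 2) * enorm (T - y) ^+ 2.
  by rewrite ler_wpM2r ?sqr_ge0// ge_min lexx orbT.
have M3 : m / 2 * enorm (y - xs) ^+ 2 <=
    m / 2 * (2 * enorm (T - xs) ^+ 2 + 2 * enorm (T - y) ^+ 2).
  by rewrite ler_wpM2l// divr_ge0// ltW.
by move: M1 M2 M3 Fge HT; lra.
Qed.

(** [Q (1 - P Q) = Q - Q P Q], where [Q] inherits symmetry from the Hessian. *)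
Lemma Bm_sym x P : (hess f x)^T = hess f x -> P^T = P ->
  (Bm f gamma x P)^T = Bm f gamma x P.
Proof.
move=> Hs Ps; have Qs : (Qm f gamma x)^T = Qm f gamma x.
  by rewrite /Qm linearB linearZ /= trmx1 Hs.
by rewrite /Bm mulmxBr mulmx1 linearZ /= linearB /= !trmx_mul Qs Ps mulmxA.
Qed.

(** * Second-order behaviour of the envelope at the critical point *)

Section NearCriticalPoint.
Variable xs : 'cV[R]_n.
Hypothesis fC2 : C2plus f.
Hypothesis proxC1 : C1_near (prox gamma g) (y_ xs).
Hypothesis xs_crit : is_prox gamma g (y_ xs) xs.

Let hess_jac x : hasjac (grad f) x (hess f x).
Proof. by apply: differentiable_hasjac; exact: fC2.2.1. Qed.

Let hess_sym x : (hess f x)^T = hess f x.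
Proof. by apply: (@jac_of_grad_sym _ _ f (grad f) x _ 1) => // z _; exact: df. Qed.

Let prox_strict : strict_jac (prox gamma g) (y_ xs) (jac (prox gamma g) (y_ xs)).
Proof.
have [r r0 [pd pc]] := proxC1; apply: (C1_strict_jac r0) => [y yr|].
  by apply: differentiable_hasjac; exact: pd.
by apply: jac_continuous => v; apply: pc; rewrite subrr enorm0.
Qed.

(** [strict_jac_mulmx] applied to the Lipschitz factor [gamma^-1 *: Qm] and the residual [y - T y],
    which vanishes at [xs]. The scalar [1 *:] only serves to reuse [strict_jac_id_sub]. *)
Lemma fbe_grad_strict : strict_jac (fun y => Qm f gamma y *m Rg f g gamma y) xs
  (Bm f gamma xs (jac (prox gamma g) (y_ xs))).
Proof.
have grad_strict : strict_jac (grad f) xs (hess f xs).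
  by apply: (C1_strict_jac ltr01) => //; exact: fC2.2.2.1.
have T_strict := @strict_jac_comp _ _ (prox gamma g) (fun y => y_ y) xs _ _
  prox_strict (strict_jac_id_sub gamma grad_strict).
have := strict_jac_id_sub 1 T_strict.
have [r r0 [K HK]] := fC2.2.2.2 xs.
move=> /(@strict_jac_mulmx _ _ (fun y => gamma^-1 *: Qm f gamma y) _ _ _ r
  (n%:R ^+ 2 * K) r0) S.
have -> : (fun y => Qm f gamma y *m Rg f g gamma y) = (fun y =>
    (gamma^-1 *: Qm f gamma y) *m
      (y - 1 *: (prox gamma g \o (fun y => y - gamma *: grad f y)) y)).
  by apply: funext => y; rewrite scale1r /Rg /Tg /= -scalemxAl -scalemxAr.
have -> : Bm f gamma xs (jac (prox gamma g) (y_ xs)) = (gamma^-1 *: Qm f gamma xs) *m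
    (1%:M - 1 *: (jac (prox gamma g) (y_ xs) *m (1%:M - gamma *: hess f xs))).
  by rewrite scale1r /Bm -scalemxAl.
apply: S => [y z u yr zr|]; last first.
  by rewrite scale1r /= -[prox _ _ _]/(Tg f g gamma xs) Tg_fixed// subrr.
rewrite -(mulmxBl (gamma^-1 *: Qm f gamma y) (gamma^-1 *: Qm f gamma z) u).
have -> : gamma^-1 *: Qm f gamma y - gamma^-1 *: Qm f gamma z = - (hess f y - hess f z).
  rewrite /Qm; move: (hess f y) (hess f z) => a b.
  by apply/matrixP => i j; rewrite !mxE; field; rewrite gt_eqF.
rewrite mulNmx enormN.
apply: le_trans (enorm_mulmx _ _) _; rewrite ler_wpM2r ?enorm_ge0// -mulrA.
by rewrite ler_wpM2l ?exprn_ge0// HK.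
Qed.

Lemma Bm_near (e : R) : 0 < e -> exists2 r : R, 0 < r &
  forall x P, enorm (x - xs) < r -> clarke (prox gamma g) (y_ x) P ->
    (Bm f gamma x P)^T = Bm f gamma x P /\
    forall u, enorm (Bm f gamma x P *m u -
      Bm f gamma xs (jac (prox gamma g) (y_ xs)) *m u) <= e * enorm u.
Proof.
move=> e0; have [r0 r00 [pd pc]] := proxC1.
have jc y : enorm (y - y_ xs) < r0 -> {for y, continuous (jac (prox gamma g))}.
  by move=> yr; apply: jac_continuous => v; exact: pc.
have opP : op_continuous (jac (prox gamma g)) (y_ xs).
  by apply/continuous_op/jc; rewrite subrr enorm0.
have opP' := @op_continuous_comp _ _ (jac (prox gamma g)) (fun y => y_ y) xs _ opP
  (fun y => forward_lipschitz y xs).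
have opQ : op_continuous (Qm f gamma) xs.
  apply: op_continuousB; first exact: op_continuous_cst.
  by apply/op_continuousZ/continuous_op; exact: fC2.2.2.1.
have opB : op_continuous (fun y => Bm f gamma y (jac (prox gamma g) (y_ y))) xs.
  apply: op_continuousZ; apply: op_continuous_mulmx => //.
  apply: op_continuousB; first exact: op_continuous_cst.
  exact: op_continuous_mulmx.
have [r r_gt0 H] := opB _ e0.
have c0 : 0 < 1 + gamma * Lf by rewrite addr_gt0// mulr_gt0.
(* The second radius keeps the forward point of [x] in the ball where the prox is continuously
   differentiable. *)
exists (Num.min r (r0 / (1 + gamma * Lf))); first by rewrite lt_min r_gt0 divr_gt0.
move=> x P; rewrite lt_min => /andP[xr'].
rewrite ltr_pdivlMr// mulrC => /(le_lt_trans (forward_lipschitz x xs)) xr.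
move=> /(clarke_C1 (jc _ xr)) ->; split.
  apply: Bm_sym => //; apply: (@prox_jac_sym (y_ x)).
  by apply: differentiable_hasjac; exact: pd.
by move=> u; exact: H.
Qed.

End NearCriticalPoint.

End ForwardBackwardEnvelope.

(** * Local convergence of the trust-region iteration *)

Section OperatorNorm.
Context {R : realType} {n : nat}.
Implicit Types (u v : 'cV[R]_n) (B : 'M[R]_n).

Lemma opnorm_le B (L : R) : 0 <= L -> (forall u, enorm (B *m u) <= L * enorm u) ->
  opnorm B <= L.
Proof.
move=> L0 BL; apply: ge_sup.
  by exists (enorm (B *m 0)), 0 => //=; rewrite enorm0 ler01.
move=> _ [u /= u1 <-]; apply: le_trans (BL u) _.
by rewrite ler_piMr.
Qed.

Lemma opnorm_ge0 B : 0 <= opnorm B.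
Proof.
have <- : enorm (B *m 0) = 0 by rewrite mulmx0 enorm0.
apply: ub_le_sup; last by exists 0 => //=; rewrite enorm0 ler01.
exists (n%:R ^+ 2 * `|B|) => _ [u /= u1 <-]; apply: le_trans (enorm_mulmx _ _) _.
by rewrite ler_piMr// mulr_ge0// exprn_ge0.
Qed.

(** Replaces [opnorm B] by a uniform bound [L], which also absorbs the convention for
    [opnorm B = 0]. *)
Lemma cauchy_rad_ge (delta L : R) v B : 0 < L -> opnorm B <= L ->
  Num.min delta (enorm v / L) <= cauchy_rad delta v B.
Proof.
move=> L0 BL; rewrite /cauchy_rad; case: ifPn => B0; first by rewrite ge_min lexx.
have B1 : 0 < opnorm B by rewrite lt_def B0 opnorm_ge0.
rewrite le_min !ge_min lexx /=; apply/orP; right.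
by rewrite ler_wpM2l ?enorm_ge0// lef_pV2.
Qed.

Lemma cauchy_rad_ge0 (delta : R) v B : 0 <= delta -> 0 <= cauchy_rad delta v B.
Proof.
move=> d0; rewrite /cauchy_rad; case: ifP => // _.
by rewrite le_min d0 divr_ge0 ?enorm_ge0 ?opnorm_ge0.
Qed.

Lemma coercive_posdef B (l : R) : 0 < l -> B^T = B ->
  (forall u, l * enorm u ^+ 2 <= dotv u (B *m u)) -> posdef B.
Proof.
move=> l0 BT Bl; split => // u u0; apply: lt_le_trans (Bl u).
by rewrite mulr_gt0// exprn_gt0// enorm_gt0.
Qed.

Lemma posdef_unitmx B : posdef B -> B \in unitmx.
Proof.
move=> [BT Bp]; rewrite unitmxE unitfE; apply/negP => /det0P[v v0 vB].
have vT0 : v^T != 0 by apply: contraNneq v0 => H; rewrite -[v]trmxK H trmx0.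
by have := Bp _ vT0; rewrite -[X in X *m _]BT -trmx_mul vB trmx0 dotv0r ltxx.
Qed.

(** Eigenvectors of [eigenvalue] are rows, hence the transposes. The lemma supplies the eigenvalue
    half of the stopping test. *)
Lemma posdef_lmin B : posdef B -> lmin_ge0 B.
Proof.
move=> [BT Bp] a /eigenvalueP[v vB v0].
have vT0 : v^T != 0 by apply: contraNneq v0 => H; rewrite -[v]trmxK H trmx0.
have := Bp _ vT0; rewrite -[X in X *m _]BT -trmx_mul vB linearZ /= dotvZr.
have : 0 < dotv v^T v^T by rewrite -enorm_sqr exprn_gt0// enorm_gt0.
by move=> p0; rewrite pmulr_lgt0// => /ltW.
Qed.

Lemma coercive_lower B (l : R) u : (l * enorm u ^+ 2 <= dotv u (B *m u)) ->
  l * enorm u <= enorm (B *m u).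
Proof.
have [->|u0] := eqVneq u 0; first by rewrite enorm0 mulr0 enorm_ge0.
move=> /le_trans/(_ (dotv_le _ _)); rewrite expr2 mulrA mulrC ler_pM2l ?enorm_gt0//.
Qed.

End OperatorNorm.

(** * An abstract trust-region run near a point of quadratic growth *)

Section TrustRegion.
Context {R : realType} {n : nat}.
Variables (phi : 'cV[R]_n -> R) (G : 'cV[R]_n -> 'cV[R]_n) (xs : 'cV[R]_n)
  (Bs : 'M[R]_n) (c0 : R).
Implicit Types (u v w y z : 'cV[R]_n) (A B : 'M[R]_n).

Hypothesis phiG : forall y, hasgrad phi y (G y).
Hypothesis GB : strict_jac G xs Bs.
Hypothesis Gxs : G xs = 0.
Hypothesis c0_gt0 : 0 < c0.
Hypothesis growth : exists2 r : R, 0 < r & forall y, enorm (y - xs) < r ->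
  phi xs + c0 * enorm (y - xs) ^+ 2 <= phi y.

(** [taylor_mvt] with [q = dotv (Bs *m v) v]. Strict differentiability lets the one matrix [Bs]
    serve at every base point [y] near [xs]. *)
Lemma quadratic_expansion (e : R) : 0 < e -> exists2 r : R, 0 < r &
  forall y v, enorm (y - xs) < r -> enorm (y + v - xs) < r ->
    `|phi (y + v) - phi y - dotv (G y) v - dotv (Bs *m v) v / 2| <= e * enorm v ^+ 2.
Proof.
move=> e0; have [r r0 H] := GB e0; exists r => // y v yr yvr.
have [//|c c01 ->] := @taylor_mvt _ _ phi G y v (dotv (Bs *m v) v).
have cr : enorm (y + c *: v - xs) < r.
  have := @segment_ball _ _ xs (y + v) y r c yvr yr c01.
  by rewrite [y + v]addrC addrK.
rewrite -dotvZl -dotvBl scalemxAr; apply: le_trans (cauchy_schwarz _ _) _.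
have := H _ _ cr yr; rewrite [y + c *: v]addrC addrK => /(ler_wpM2r (enorm_ge0 v)).
move=> /le_trans; apply; rewrite enormZ expr2 mulrA ler_wpM2r ?enorm_ge0//.
move: c01 => /andP[? ?].
by rewrite ler_wpM2l ?(ltW e0)// ger0_norm// ler_piMl ?enorm_ge0.
Qed.

(** Growth and the expansion at [xs] with error [c0 / 2] are compared along a short multiple of [v];
    the linear term vanishes because [G xs = 0]. *)
Lemma hessian_coercive v : c0 * enorm v ^+ 2 <= dotv v (Bs *m v).
Proof.
have c2 : 0 < c0 / 2 by rewrite divr_gt0.
have [r r0 H] := quadratic_expansion c2; have [r1 r10 H1] := growth.
have [->|v0] := eqVneq v 0; first by rewrite enorm0 dotv0l expr0n mulr0.
have vp : 0 < enorm v by rewrite enorm_gt0.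
pose t := Num.min r r1 / 2 / enorm v.
have m0 : 0 < Num.min r r1 by rewrite lt_min r0.
have t0 : 0 < t by rewrite !divr_gt0.
have : enorm (xs + t *: v - xs) < Num.min r r1.
  rewrite [xs + _]addrC addrK enormZ gtr0_norm// divfK ?gt_eqF//; lra.
rewrite lt_min => /andP[L1 L2].
have := H xs (t *: v); rewrite subrr enorm0 => /(_ r0 L1).
have := H1 _ L2; rewrite [xs + _]addrC addrK Gxs dotv0l.
rewrite enormZ gtr0_norm// exprMn -scalemxAr dotvZl dotvZr (dotvC _ v).
rewrite ler_norml => a1 /andP[_ a2].
have t2 : 0 < t ^+ 2 by rewrite exprn_gt0.
rewrite -(ler_pM2l t2); move: a1 a2; rewrite expr2 in t2 *; lra.
Qed.

Section Run.
Variables (beta mu1 mu2 c1 c2 c3 : R) (x : nat -> 'cV[R]_n)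
  (delta : nat -> R) (B : nat -> 'M[R]_n) (d : nat -> 'cV[R]_n).

Definition pred_red k := - (dotv (G (x k)) (d k) + dotv (B k *m d k) (d k) / 2).
Definition ratio k := (phi (x k) - phi (x k + d k)) / pred_red k.
Definition newton k := - (invmx (B k) *m G (x k)).

Hypothesis delta0_gt0 : 0 < delta 0%N.
Hypothesis mu1_gt0 : 0 < mu1.
Hypothesis mu12 : mu1 < mu2.
Hypothesis mu2_lt1 : mu2 < 1.
Hypothesis c1_gt0 : 0 < c1.
Hypothesis c12 : c1 < c2.
Hypothesis c3_gt1 : 1 < c3.
Hypothesis d_le : forall k, enorm (d k) <= delta k.
Hypothesis x_next : forall k, x k.+1 = if ratio k < mu1 then x k else x k + d k.
Hypothesis delta_next : forall k, delta k.+1 =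
  if ratio k < mu1 then c1 * delta k else if ratio k < mu2 then c2 * delta k
  else c3 * delta k.
Hypothesis beta_gt0 : 0 < beta.
Hypothesis cauchy_decrease : forall k,
  beta * enorm (G (x k)) * cauchy_rad (delta k) (G (x k)) (B k) <= pred_red k.
Hypothesis newton_step : forall k, posdef (B k) -> enorm (newton k) <= delta k ->
  d k = newton k.
Hypothesis limit_point : forall e : R, 0 < e -> exists k, enorm (x k - xs) < e.
Hypothesis B_near : forall e : R, 0 < e -> exists2 r : R, 0 < r &
  forall k, enorm (x k - xs) < r ->
    (B k)^T = B k /\ forall u, enorm (B k *m u - Bs *m u) <= e * enorm u.
Hypothesis x_neq : forall k, posdef (B k) -> x k != xs.

Lemma delta_gt0 k : 0 < delta k.
Proof.
have c30 : 0 < c3 := lt_trans ltr01 c3_gt1.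
elim: k => // k IH; rewrite delta_next; case: ifP => _; first exact: mulr_gt0.
case: ifP => _; apply: mulr_gt0 => //; exact: lt_trans c12.
Qed.

Lemma phi_nonincreasing k : phi (x k.+1) <= phi (x k).
Proof.
rewrite x_next; case: ltP => // H.
have P0 : 0 <= pred_red k.
  apply: le_trans (cauchy_decrease k); rewrite !mulr_ge0 ?enorm_ge0 ?(ltW beta_gt0)//.
  by rewrite cauchy_rad_ge0// ltW// delta_gt0.
(* Division by zero yields ratio 0, which is below [mu1], so such a step would have been
   rejected. *)
have [P|P] := eqVneq (pred_red k) 0.
  by move: H; rewrite /ratio P invr0 mulr0 leNgt mu1_gt0.
have {P0}P : 0 < pred_red k by rewrite lt_def P.
by have := le_trans (ltW mu1_gt0) H; rewrite pmulr_lge0 ?invr_gt0// subr_ge0.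
Qed.

Lemma B_near_coercive : exists2 r : R, 0 < r & forall k, enorm (x k - xs) < r ->
  posdef (B k) /\ forall u, c0 / 2 * enorm u ^+ 2 <= dotv u (B k *m u).
Proof.
have c2' : 0 < c0 / 2 by rewrite divr_gt0.
have [r r0 H] := B_near c2'; exists r => // k /H[BT Bu].
have C u : c0 / 2 * enorm u ^+ 2 <= dotv u (B k *m u).
  have := hessian_coercive u; rewrite -(subrK (Bs *m u) (B k *m u)) dotvDr.
  have := cauchy_schwarz u (B k *m u - Bs *m u); rewrite ler_norml => /andP[+ _].
  have := ler_wpM2l (enorm_ge0 u) (Bu u).
  have -> : enorm u * (c0 / 2 * enorm u) = c0 / 2 * enorm u ^+ 2 by ring.
  by lra.
by split=> //; exact: coercive_posdef C.
Qed.

(** Coercivity gives [|Bs (y - xs)| >= c0 |y - xs|], while the linearization error is at most half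
    of that, so [xs] is an isolated zero of [G]. *)
Lemma G_near : exists2 r : R, 0 < r & exists2 C : R, 0 < C &
  forall y, enorm (y - xs) < r -> (G y = 0 -> y = xs) /\
    enorm (G y) <= C * enorm (y - xs).
Proof.
have [r1 r10 [C C0 HC]] := hasjac_lip (strict_jac_hasjac GB).
have c2' : 0 < c0 / 2 by rewrite divr_gt0.
have [r2 r20 H] := strict_jac_hasjac GB c2'.
exists (Num.min r1 r2); first by rewrite lt_min r10.
exists C => // y; rewrite lt_min => /andP[/HC + /H]; rewrite Gxs !subr0.
move=> ? S; split=> // Gy; move: S; rewrite Gy sub0r enormN => S.
have := coercive_lower (hessian_coercive (y - xs)).
move=> /le_trans/(_ S) Hy.
apply/eqP; rewrite -subr_eq0 -normr_le0; apply: le_trans (norm_le_enorm _) _.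
by rewrite -(ler_pM2l c2') mulr0; lra.
Qed.

(* Nonnegativity of the predicted reduction gives [c0/4 |d| <= |G x|], so by the
   Cauchy decrease the predicted reduction is at least [kappa |d|^2]. *)
Lemma successful_near : exists2 r : R, 0 < r & exists2 C : R, 0 < C &
  forall k, enorm (x k - xs) < r ->
    enorm (d k) <= C * enorm (x k - xs) /\ mu2 <= ratio k.
Proof.
have [rb rb0 HB] := B_near_coercive.
have [rg rg0 [C C0 HG]] := G_near.
have [rl rl0 HL] := B_near ltr01.
pose L : R := n%:R ^+ 2 * `|Bs| + 1.
have L0 : 0 < L by rewrite ltr_wpDl// mulr_ge0// exprn_ge0.
(* From the Cauchy decrease with [|G| >= c0 / 4 |d|], the radius [delta >= |d|] and
   [opnorm (B k) <= L]. *)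
pose kappa := beta * (c0 / 4) * Num.min 1 (c0 / 4 / L).
have k0 : 0 < kappa by rewrite !mulr_gt0// lt_min ltr01 !mulr_gt0// invr_gt0.
(* The Taylor remainder [e |d|^2] and the matrix error [e / 2 |d|^2] together stay below [(1 - mu2)]
   times the predicted reduction. *)
pose e := (1 - mu2) * kappa / 2.
have e0 : 0 < e by rewrite divr_gt0// mulr_gt0// subr_gt0.
have [re re0 HE] := B_near e0.
have [rq rq0 HQ] := quadratic_expansion e0.
pose C' := 4 / c0 * C.
have C'0 : 0 < C' by rewrite mulr_gt0// divr_gt0.
(* The first entry keeps [x k + d k], and not only [x k], within reach of the quadratic
   expansion. *)
pose r := Num.min (rq / (1 + C')) (Num.min rb (Num.min rg (Num.min rl (Num.min re rq)))).
exists r; first by rewrite !lt_min divr_gt0 ?addr_gt0// rb0 rg0 rl0 re0.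
exists C' => // k; rewrite !lt_min => /andP[xq /and5P[/HB[Bpd Bl] /HG[G0 GC]]].
move=> /HL[_ Bop] /HE[_ Be] xq'.
have Gn0 : 0 < enorm (G (x k)).
  rewrite enorm_gt0; apply/eqP => /G0 xk.
  by have := x_neq Bpd; rewrite xk eqxx.
have BL : opnorm (B k) <= L.
  apply: opnorm_le (ltW L0) _ => u; rewrite -(subrK (Bs *m u) (B k *m u)).
  apply: le_trans (ler_enormD _ _) _; rewrite mulrDl addrC lerD ?enorm_mulmx//.
have P1 := le_trans (ler_wpM2l (mulr_ge0 (ltW beta_gt0) (enorm_ge0 _))
  (cauchy_rad_ge (delta k) (G (x k)) L0 BL)) (cauchy_decrease k).
have P0 : 0 < pred_red k.
  by apply: lt_le_trans P1; rewrite !mulr_gt0// lt_min delta_gt0 divr_gt0.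
have dG : c0 / 4 * enorm (d k) <= enorm (G (x k)).
  have [d0|d0] := eqVneq (d k) 0; first by rewrite d0 enorm0 mulr0 enorm_ge0.
  suff : c0 / 4 * enorm (d k) ^+ 2 <= enorm (G (x k)) * enorm (d k).
    by rewrite expr2 mulrA ler_pM2r ?enorm_gt0.
  have := ltW P0; rewrite /pred_red (dotvC (B k *m _)).
  have := cauchy_schwarz (G (x k)) (d k); rewrite ler_norml => /andP[+ _].
  by have := Bl (d k); lra.
have dC : enorm (d k) <= C' * enorm (x k - xs).
  have c4 : 0 < c0 / 4 by rewrite divr_gt0.
  rewrite -(ler_pM2l c4) (_ : _ * (C' * _) = C * enorm (x k - xs)).
    exact: le_trans GC.
  by rewrite /C'; field; rewrite gt_eqF.
split=> //.
have P2 : kappa * enorm (d k) ^+ 2 <= pred_red k.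
  apply: le_trans P1.
  have -> : kappa * enorm (d k) ^+ 2 = beta * (c0 / 4 * enorm (d k)) *
     (Num.min 1 (c0 / 4 / L) * enorm (d k)) by rewrite /kappa; ring.
  have m1 : 0 <= Num.min 1 (c0 / 4 / L) * enorm (d k).
    rewrite mulr_ge0 ?enorm_ge0// le_min ler01.
    by rewrite !mulr_ge0 ?invr_ge0 ?(ltW c0_gt0) ?(ltW L0).
  apply: ler_pM => //.
    by rewrite !mulr_ge0 ?enorm_ge0 ?(ltW c0_gt0) ?(ltW beta_gt0).
    by rewrite ler_pM2l.
  rewrite le_min; apply/andP; split.
    by apply: le_trans (d_le k); rewrite ler_piMl ?enorm_ge0// ge_min lexx.
  apply: (@le_trans _ _ (c0 / 4 / L * enorm (d k))).
    by rewrite ler_wpM2r ?enorm_ge0// ge_min lexx orbT.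
  by rewrite mulrAC ler_wpM2r// invr_ge0 ltW.
rewrite /ratio ler_pdivlMr//.
have xdq : enorm (x k + d k - xs) < rq.
  rewrite addrAC; apply: le_lt_trans (ler_enormD _ _) _.
  rewrite ltr_pdivlMr ?addr_gt0// in xq; apply: le_lt_trans xq; lra.
have := HQ _ _ xq' xdq; rewrite ler_norml => /andP[_ Q].
have := cauchy_schwarz (B k *m d k - Bs *m d k) (d k).
rewrite ler_norml dotvBl => /andP[E1 _].
have E2 : enorm (B k *m d k - Bs *m d k) * enorm (d k) <= e * enorm (d k) ^+ 2.
  by rewrite expr2 mulrA ler_wpM2r ?enorm_ge0.
have E3 : e * enorm (d k) ^+ 2 <= (1 - mu2) / 2 * pred_red k.
  have -> : e * enorm (d k) ^+ 2 = (1 - mu2) / 2 * (kappa * enorm (d k) ^+ 2).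
    by rewrite /e; ring.
  by rewrite ler_wpM2l// divr_ge0// subr_ge0 ltW.
have P3 : 0 <= (1 - mu2) * pred_red k by rewrite mulr_ge0 ?subr_ge0 ?(ltW mu2_lt1) ?ltW.
move: E3 P3 E1 E2 Q; rewrite /pred_red.
move: (e * _) (phi _) (phi _) (enorm _ * enorm _) => E ph1 ph2 T.
move: (dotv (G _) _) (dotv (B k *m _) _) (dotv (Bs *m _) _) => a b c.
by lra.
Qed.

(* Once [phi (x k) - phi xs < c0 q^2], the quadratic growth keeps every later
   iterate in the ball of radius [q]: a single step is too short to leave the
   region where the growth bound holds. *)
Lemma iterates_converge (e : R) : 0 < e ->
  exists K, forall k, (K <= k)%N -> enorm (x k - xs) < e.
Proof.
move=> e0; have [r r0 [C C0 HS]] := successful_near.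
have [r1 r10 Hgr] := growth.
have [q q0 [qe qr qr1]] : exists2 q : R, 0 < q & [/\ q <= e, q <= r & (1 + C) * q <= r1].
  have c1' : 0 < 1 + C by rewrite addr_gt0.
  exists (Num.min e (Num.min r (r1 / (1 + C)))).
    by rewrite !lt_min e0 r0 divr_gt0.
  by split; rewrite 1?mulrC -?ler_pdivlMr// !ge_min lexx ?orbT.
have cq : 0 < c0 * q ^+ 2 by rewrite mulr_gt0// exprn_gt0.
(* As [G xs = 0], this reads [|phi y - phi xs| <= |y - xs|] near [xs], so a close enough iterate has
   its excess value below [c0 * q ^+ 2]. *)
have [r2 r20 Hc] := phiG xs ltr01.
have m0 : 0 < Num.min q (Num.min r2 (c0 * q ^+ 2)) by rewrite !lt_min q0 r20.
have [K] := limit_point m0; rewrite !lt_min => /and3P[Kq /Hc KH Kc].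
exists K.
suff inv k : (K <= k)%N -> enorm (x k - xs) < q /\ phi (x k) - phi xs < c0 * q ^+ 2.
  by move=> k /inv[kq _]; exact: lt_le_trans kq qe.
move=> /subnKC <-; elim: (k - K)%N => [|j]; rewrite ?addn0 ?addnS.
  split=> //; apply: le_lt_trans Kc.
  by move: KH; rewrite Gxs dotv0l subr0 mul1r; exact/le_trans/ler_norm.
move: (K + j)%N => {}k [kq kphi].
have phik : phi (x k.+1) - phi xs < c0 * q ^+ 2.
  by apply: le_lt_trans kphi; rewrite lerD2r phi_nonincreasing.
split=> //.
have kr : enorm (x k - xs) < r := lt_le_trans kq qr.
have kr1 : (1 + C) * enorm (x k - xs) < r1.
  by apply: lt_le_trans qr1; rewrite ltr_pM2l// addr_gt0.
have [dC _] := HS _ kr.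
have near : enorm (x k.+1 - xs) < r1.
  apply: le_lt_trans kr1; rewrite x_next mulrDl mul1r; case: ifP => _.
    by rewrite lerDl mulr_ge0 ?enorm_ge0// ltW.
  by rewrite addrAC; apply: le_trans (ler_enormD _ _) _; rewrite lerD2l.
rewrite -(@ltr_pXn2r _ 2) ?nnegrE ?enorm_ge0 ?(ltW q0)// -(ltr_pM2l c0_gt0).
by apply: le_lt_trans phik; have := Hgr _ near; lra.
Qed.

(** Near [xs] every radius is multiplied by [c3], and Bernoulli's bound [1 + j (c3 - 1)] on the
    powers suffices. The level 1 is the one that the Newton steps are compared with. *)
Lemma radius_unbounded : exists K, forall k, (K <= k)%N -> 1 <= delta k.
Proof.
have [r r0 [C C0 HS]] := successful_near.
have [K HK] := iterates_converge r0.
have step k : (K <= k)%N -> delta k.+1 = c3 * delta k.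
  move=> /HK/HS[_ m2]; rewrite delta_next ltNge (le_trans (ltW mu12) m2) /=.
  by rewrite ltNge m2.
have grow j : delta K * (1 + j%:R * (c3 - 1)) <= delta (K + j)%N.
  elim: j => [|j IH]; first by rewrite mul0r addr0 mulr1 addn0.
  rewrite addnS step ?leq_addr//.
  have c30 : 0 < c3 - 1 by rewrite subr_gt0.
  have := ler_wpM2l (ltW c30) IH; rewrite -natr1.
  have H : 0 <= (c3 - 1) * (delta K * (j%:R * (c3 - 1))).
    by rewrite !mulr_ge0// ?(ltW c30)// ltW// delta_gt0.
  move: IH H; lra.
have dK : 0 < delta K * (c3 - 1) by rewrite mulr_gt0 ?delta_gt0// subr_gt0.
exists (K + (Num.truncn (delta K * (c3 - 1))^-1).+1)%N => k Kk.
rewrite -(subnKC (leq_trans (leq_addr _ _) Kk)); apply: le_trans (grow _).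
set j := (k - K)%N.
have : (delta K * (c3 - 1))^-1 <= j%:R.
  apply: ltW; apply: lt_le_trans (truncnS_gt _) _; rewrite ler_nat.
  by rewrite /j leq_subRL// (leq_trans (leq_addr _ _) Kk).
rewrite -(ler_pM2l dK) divff ?gt_eqF// => H.
by have := delta_gt0 K; lra.
Qed.

Lemma eventually_newton : exists K, forall k, (K <= k)%N ->
  [/\ posdef (B k), d k = newton k, mu1 <= ratio k & x k.+1 = x k + d k].
Proof.
have [r r0 [C C0 HS]] := successful_near.
have [rb rb0 HB] := B_near_coercive.
have [rg rg0 [Cg Cg0 HG]] := G_near.
have c2' : 0 < c0 / 2 by rewrite divr_gt0.
(* The last entry forces [|G (x k)| <= c0 / 2], so by coercivity the Newton step has length at most
   1. *)
pose e := Num.min r (Num.min rb (Num.min rg (c0 / 2 / Cg))).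
have e0 : 0 < e by rewrite !lt_min r0 rb0 rg0 !divr_gt0.
have [K1 HK1] := iterates_converge e0; have [K2 HK2] := radius_unbounded.
exists (maxn K1 K2) => k; rewrite geq_max => /andP[/HK1 + /HK2 dk1].
rewrite !lt_min => /and4P[/HS[_ m2] /HB[Bpd Bl] /HG[_ GC] xk].
have m1 : mu1 <= ratio k := le_trans (ltW mu12) m2.
split=> //; last by rewrite x_next ltNge m1.
apply: newton_step => //; apply: le_trans dk1; rewrite /newton enormN.
have := coercive_lower (Bl (invmx (B k) *m G (x k))).
rewrite mulmxA mulmxV ?posdef_unitmx// mul1mx => H.
rewrite -(ler_pM2l c2') mulr1; apply: le_trans H _; apply: le_trans GC _.
by rewrite mulrC -ler_pdivlMr// ltW.
Qed.

(** Applying [B k] to the new error gives [(B k - Bs) (x k - xs) - (G (x k) - Bs (x k - xs))]. Both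
    terms are [o(|x k - xs|)], and coercivity of [B k] transfers this to the error itself. *)
Lemma superlinear (e : R) : 0 < e -> exists K, forall k, (K <= k)%N ->
  enorm (x k.+1 - xs) <= e * enorm (x k - xs).
Proof.
move=> e0; have [rb rb0 HB] := B_near_coercive.
have c2' : 0 < c0 / 2 by rewrite divr_gt0.
have e1 : 0 < c0 / 2 * e / 2 by rewrite divr_gt0// mulr_gt0.
have [r1 r10 H1] := B_near e1; have [r2 r20 H2] := strict_jac_hasjac GB e1.
have m0 : 0 < Num.min rb (Num.min r1 r2) by rewrite !lt_min rb0 r10.
have [K1 HK1] := iterates_converge m0; have [K2 HK2] := eventually_newton.
exists (maxn K1 K2) => k; rewrite geq_max => /andP[/HK1 + /HK2[_ dk _ ->]].
rewrite !lt_min dk => /and3P[/HB[Bpd Bl] /H1[_ {}H1] /H2].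
rewrite Gxs subr0 => {}H2.
have := coercive_lower (Bl (x k + newton k - xs)).
have -> : B k *m (x k + newton k - xs) = B k *m (x k - xs) - G (x k).
  rewrite addrAC mulmxDr /newton mulmxN mulmxA mulmxV ?posdef_unitmx//.
  by rewrite mul1mx.
move=> H; rewrite -(ler_pM2l c2'); apply: le_trans H _.
have -> : B k *m (x k - xs) - G (x k) = (B k *m (x k - xs) - Bs *m (x k - xs))
   - (G (x k) - Bs *m (x k - xs)) by rewrite opprB addrA subrK.
apply: le_trans (ler_enormB _ _) _; have := H1 (x k - xs); lra.
Qed.

End Run.
End TrustRegion.

(** * NTRA as an instance of the abstract trust-region run *)

Theorem theorem4p11 (R : realType) (n : nat)
  (f : 'cV[R]_n -> R) (g : 'cV[R]_n -> \bar R) (Lf rho : R) (xstar : 'cV[R]_n) :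
  0 < Lf -> 0 < rho ->
  C2plus f ->
  (forall x y, enorm (grad f x - grad f y) <= Lf * enorm (x - y)) ->
  proper_fun g -> lower_semicontinuous g -> weakly_convex rho g ->
  (exists z, forall x, ((f z)%:E + g z <= (f x)%:E + g x)%E) ->
  C3_near f xstar ->
  (exists2 c : R, 0 < c & exists2 eps : R, 0 < eps & forall x,
     enorm (x - xstar) < eps ->
     ((f x)%:E + g x >= (f xstar)%:E + g xstar + (c * enorm (x - xstar) ^+ 2)%:E)%E) ->
  exists2 gbar : R, 0 < gbar &
  forall (gamma delta0 mu1 mu2 c1 c2 c3 : R) (x0 : 'cV[R]_n)
         (x : nat -> 'cV[R]_n) (delta : nat -> R)
         (P : nat -> 'M[R]_n) (d : nat -> 'cV[R]_n),
  0 < gamma -> gamma < Num.min (Lf^-1) (rho^-1) -> gamma < gbar ->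
  0 < delta0 -> 0 < mu1 -> mu1 < mu2 -> mu2 < 1 ->
  0 < c1 -> c1 < c2 -> c2 < 1 -> 1 < c3 ->
  (exists M : R, forall y,
     ((f y)%:E + g y <= (f x0)%:E + g x0)%E -> enorm y <= M) ->
  NTRA_run f g gamma delta0 mu1 mu2 c1 c2 c3 x0 x delta P d ->
  is_prox gamma g (xstar - gamma *: grad f xstar) xstar ->
  (forall eps : R, 0 < eps -> forall N : nat, exists2 k : nat, (N <= k)%N &
     enorm (x k - xstar) < eps) ->
  C1_near (prox gamma g) (xstar - gamma *: grad f xstar) ->
  (exists2 beta : R, 0 < beta < 1 & forall k : nat,
     model f g gamma (x k) (P k) 0 - model f g gamma (x k) (P k) (d k)
     >= beta * enorm (grad (fbe f g gamma) (x k)) *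
        cauchy_rad (delta k) (grad (fbe f g gamma) (x k)) (Bm f gamma (x k) (P k))) ->
  (forall k : nat, posdef (Bm f gamma (x k) (P k)) ->
     enorm (newton_dir f g gamma (x k) (P k)) <= delta k ->
     d k = newton_dir f g gamma (x k) (P k)) ->
  (* (i) *)
  x @ \oo --> xstar /\
  (* (ii) *)
  (exists K : nat, forall k : nat, (K <= k)%N ->
     [/\ posdef (Bm f gamma (x k) (P k)),
         d k = newton_dir f g gamma (x k) (P k),
         mu1 <= tr_ratio f g gamma (x k) (P k) (d k) &
         x k.+1 = x k + d k]) /\
  (forall eps : R, 0 < eps -> exists K : nat, forall k : nat, (K <= k)%N ->
     enorm (x k.+1 - xstar) <= eps * enorm (x k - xstar)).
Proof.
move=> Lf0 rho0 fC2 gradLip gproper glsc gwc phimin _ [c c_gt0 [eps eps0 strong]].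
exists 1 => // gamma delta0 mu1 mu2 c1 c2 c3 x0 x delta P d.
move=> gamma0; rewrite lt_min => /andP[gammaLf gammarho] _ delta0_gt0 mu10 mu12 mu21.
move=> c10 c12 c21 c31 _ [x_0 [delta_0 run]] crit limpt proxC1.
move=> [beta /andP[beta0 _] cauchy] newt.
have df y : hasgrad f y (grad f y) by apply: differentiable_hasgrad; exact: fC2.1.
have [c0 c00 growth] := fbe_growth Lf0 rho0 gamma0 gammaLf gammarho df gradLip
  gproper glsc gwc phimin crit c_gt0 eps0 strong.
have Txs := Tg_fixed Lf0 rho0 gamma0 gammaLf gammarho df gradLip
  gproper glsc gwc phimin crit.
have Rxs : Rg f g gamma xstar = 0 by rewrite /Rg Txs subrr scaler0.
have strict := fbe_grad_strict Lf0 rho0 gamma0 gammaLf gammarho df gradLip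
  gproper glsc gwc phimin fC2 proxC1 crit.
have near := Bm_near Lf0 rho0 gamma0 gammaLf gammarho df gradLip
  gproper glsc gwc phimin fC2 proxC1.
set G := fun y => Qm f gamma y *m Rg f g gamma y in strict.
have phiG y : hasgrad (fbe f g gamma) y (G y).
  apply: (fbe_hasgrad Lf0 rho0 gamma0 gammaLf gammarho df gradLip
    gproper glsc gwc phimin).
  by apply: differentiable_hasjac; exact: fC2.2.1.
have gradG y : grad (fbe f g gamma) y = G y := hasgradE (phiG y).
have Gxs : G xstar = 0 by rewrite /G Rxs mulmx0.
pose B k := Bm f gamma (x k) (P k).
have predE k : model f g gamma (x k) (P k) 0 - model f g gamma (x k) (P k) (d k) =
    pred_red G x B d k.
  by rewrite /model /pred_red gradG mulmx0 !dotv0r -/(B k); field.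
have ratioE k : tr_ratio f g gamma (x k) (P k) (d k) = ratio (fbe f g gamma) G x B d k.
  by rewrite /tr_ratio predE.
have newtE k : newton_dir f g gamma (x k) (P k) = newton G x B k.
  by rewrite /newton_dir gradG.
have d_le k : enorm (d k) <= delta k by have [] := run k.
have x_next k : x k.+1 =
    if ratio (fbe f g gamma) G x B d k < mu1 then x k else x k + d k.
  by have [_ _ _ + _] := run k; rewrite ratioE.
have delta_next k : delta k.+1 = if ratio (fbe f g gamma) G x B d k < mu1
    then c1 * delta k else if ratio (fbe f g gamma) G x B d k < mu2
    then c2 * delta k else c3 * delta k.
  by have [_ _ _ _] := run k; rewrite ratioE.
have decrease k : beta * enorm (G (x k)) * cauchy_rad (delta k) (G (x k)) (B k)
    <= pred_red G x B d k by rewrite -predE -gradG; exact: cauchy.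
have newton_step k : posdef (B k) -> enorm (newton G x B k) <= delta k ->
    d k = newton G x B k by rewrite -newtE; exact: newt.
have limit_point (e : R) : 0 < e -> exists k, enorm (x k - xstar) < e.
  by move=> /limpt/(_ 0%N)[k _ xk]; exists k.
have B_near (e : R) : 0 < e -> exists2 r : R, 0 < r &
    forall k, enorm (x k - xstar) < r -> (B k)^T = B k /\ forall u,
      enorm (B k *m u -
        Bm f gamma xstar (jac (prox gamma g) (xstar - gamma *: grad f xstar)) *m u)
      <= e * enorm u.
  move=> /near[r r0 H]; exists r => // k xk.
  by apply: H xk _; have [] := run k.
(* At [xstar] the residual vanishes, so a positive definite [B k] there would meet the stopping
   test, which an infinite run never does. *)
have x_neq k : posdef (B k) -> x k != xstar.
  move=> Bpd; apply/eqP => xk; have [_ stop _ _ _] := run k; apply: stop.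
  by rewrite {1}xk; split => //; exact: posdef_lmin.
have delta00 : 0 < delta 0%N by rewrite delta_0.
have conv := iterates_converge phiG strict Gxs c00 growth delta00 mu10 mu21 c10 c12
  c31 d_le x_next delta_next beta0 decrease limit_point B_near x_neq.
have [K HK] := eventually_newton phiG strict Gxs c00 growth delta00 mu10 mu12 mu21 c10
  c12 c31 d_le x_next delta_next beta0 decrease newton_step limit_point B_near x_neq.
have superlin := superlinear phiG strict Gxs c00 growth delta00 mu10 mu12 mu21 c10
  c12 c31 d_le x_next delta_next beta0 decrease newton_step limit_point B_near x_neq.
split; first exact/cvg_enormP.
split=> //; exists K => k /HK[Bpd dk m1 xk].
by rewrite ratioE newtE.
Qed.
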